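(* Let $\lambda\geq 3$ be an integer and let $a\in[-1,1]$ with $a\neq0$. Let $\mu_{a,\lambda}$ be the Riesz product with $\lambda_j=\lambda^j$ and $a_j=a$ for all $j\geq1$. Then, for $\theta\in[0,1]$, \[ \dim_{\mathrm F}^{\theta}\mu_{a,\lambda}=\theta-\theta\,\frac{\log\left(1+|a|^{2/\theta}2^{1-2/\theta}\right)}{\log\lambda}, \] where at $\theta=0$ the right-hand side is interpreted as $0$.
   Context: For sequences $a_j\in[-1,1]$ and $\lambda_j\in\mathbb{N}$ with $\lambda_{j+1}\geq3\lambda_j$, the Riesz product $\prod_{j=1}^\infty(1+a_j\cos(2\pi\lambda_j x))$, $x\in[0,1]$, is the finite Borel measure on $[0,1]\subseteq\mathbb{R}$ obtained as the weak limit as $N\to\infty$ of the absolutely continuous measures on $[0,1]$ with densities $\prod_{j=1}^N(1+a_j\cos(2\pi\lambda_j x))$. For a finite Borel measure $\mu$ on $\mathbb{R}$ write $\widehat\mu(z)=\int e^{-2\pi i zx}\,d\mu(x)$. For $s\geq 0$ and $\theta\in(0,1]$ let $\mathcal{J}_{s,\theta}(\mu)=\left(\int_{\mathbb{R}}|\widehat\mu(z)|^{2/\theta}|z|^{s/\theta-1}\,dz\right)^{\theta}$, and let $\mathcal{J}_{s,0}(\mu)=\sup_{z\in\mathbb{R}}|\widehat\mu(z)|^2|z|^s$. The Fourier spectrum of $\mu$ at $\theta\in[0,1]$ is $\dim_{\mathrm F}^{\theta}\mu=\sup\{s\geq 0:\mathcal{J}_{s,\theta}(\mu)<\infty\}$,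 with $\sup\emptyset=0$. *)

(* Defs.v *)
From HB Require Import structures.
From mathcomp Require Import all_boot all_order all_algebra.
From mathcomp Require Import all_classical all_reals all_analysis.
From mathcomp Require Import measurable_realfun complex.

Set Implicit Arguments.
Unset Strict Implicit.
Unset Printing Implicit Defensive.
Import Order.TTheory GRing.Theory Num.Theory.
Import numFieldNormedType.Exports.

Local Open Scope classical_set_scope.
Local Open Scope ring_scope.

(* The integrals are extended-real valued, but finite for bounded [f]. *)
Definition weak_cvg {R : realType}
    (nu : nat -> {finite_measure set (measurableTypeR R) -> \bar R})
    (mu : {finite_measure set (measurableTypeR R) -> \bar R}) : Prop :=
  forall f : R -> R, continuous f -> [bounded f x | x in [set: R]] ->
    (\int[nu N]_x (f x)%:E)%E @[N --> \oo] --> (\int[mu]_x (f x)%:E)%E.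

Section RieszProduct.
Context {R : realType}.
Implicit Types (a : nat -> R) (l : nat -> nat) (N : nat).

(* The values [a 0] and [l 0] are unused: the factors are j = 1, ..., N. *)
Definition riesz_density a l N (x : R) : R :=
  \prod_(1 <= j < N.+1) (1 + a j * cos (2 * pi * (l j)%:R * x)).

(* [ha] is not used by the formula, but by the measure instance below. *)
Definition riesz_partial a (ha : forall j, -1 <= a j <= 1) l N :
    set (measurableTypeR R) -> \bar R :=
  fun A => (\int[lebesgue_measure]_(x in A `&` `[0%R, 1%R]%classic)
    (riesz_density a l N x)%:E)%E.

Section instances.
Variables (a : nat -> R) (ha : forall j, -1 <= a j <= 1).
Variables (l : nat -> nat) (N : nat).

Lemma riesz_factor_itv j (x : R) :
  0 <= 1 + a j * cos (2 * pi * (l j)%:R * x) <= 2.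
Proof.
set c := cos _.
have : `|a j * c| <= 1.
  rewrite normrM mulr_ile1// ?normr_ge0// ler_norml ?ha//.
  by rewrite cos_geN1 cos_le1.
rewrite ler_norml => /andP[h1 h2].
by rewrite -lerBlDl sub0r h1/= -[2]/(1 + 1) lerD2l.
Qed.

Lemma riesz_density_ge0 x : 0 <= riesz_density a l N x.
Proof. by apply: prodr_ge0 => j _; case/andP: (riesz_factor_itv j x). Qed.

Lemma riesz_density_le x : riesz_density a l N x <= 2 ^+ N.
Proof.
rewrite /riesz_density -[in leRHS](subn0 N) -[in leRHS]subSS.
rewrite -prodr_const_nat.
by apply: ler_prod => j _; exact: riesz_factor_itv.
Qed.

Lemma measurable_riesz_density :
  measurable_fun [set: measurableTypeR R] (riesz_density a l N).
Proof.
apply: measurable_prod => j _.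
apply: measurable_funD => //; apply: measurable_funM => //.
apply: measurableT_comp.
  by apply: continuous_measurable_fun; exact: continuous_cos.
exact: measurable_funM.
Qed.

Let riesz_partial0 : riesz_partial ha l N set0 = 0%E.
Proof. by rewrite /riesz_partial set0I integral_set0. Qed.

Let riesz_partial_ge0 A : (0 <= riesz_partial ha l N A)%E.
Proof. by apply: integral_ge0 => x _; rewrite lee_fin riesz_density_ge0. Qed.

Let riesz_partial_sigma_additive : semi_sigma_additive (riesz_partial ha l N).
Proof.
move=> F mF tF mUF; rewrite /riesz_partial; apply: cvg_toP.
  apply: ereal_nondecreasing_is_cvgn => m n mn.
  by apply: lee_sum_nneg_natr => // k _ _; exact: riesz_partial_ge0.
rewrite setI_bigcupl ge0_integral_bigcup//=.
- by move=> k; apply: measurableI.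
- apply: measurable_funTS; apply: measurableT_comp => //.
  exact: measurable_riesz_density.
- by move=> x _; rewrite lee_fin riesz_density_ge0.
- exact: trivIset_setIr.
Qed.

HB.instance Definition _ := isMeasure.Build _ _ _ (riesz_partial ha l N)
  riesz_partial0 riesz_partial_ge0 riesz_partial_sigma_additive.

Let riesz_partial_fin : fin_num_fun (riesz_partial ha l N).
Proof.
move=> A mA; rewrite ge0_fin_numE ?riesz_partial_ge0//.
have mI : measurable (A `&` `[0%R, 1%R]%classic : set (measurableTypeR R)).
  exact: measurableI.
apply: (@le_lt_trans _ _ (\int[lebesgue_measure]_(x in
    (A `&` `[0%R, 1%R]%classic : set (measurableTypeR R))) (2 ^+ N : R)%:E)%E).
  apply: ge0_le_integral => //.
  - by move=> x _; rewrite lee_fin riesz_density_ge0.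
  - apply: measurable_funTS; apply: measurableT_comp => //.
    exact: measurable_riesz_density.
  - by move=> x _; rewrite lee_fin riesz_density_le.
rewrite integral_cst// lte_mul_pinfty// ?lee_fin ?exprn_ge0//.
apply: (@le_lt_trans _ _ (lebesgue_measure (`[0%R, 1%R]%classic : set R))).
  by apply: le_measure; rewrite ?inE//; exact: subIsetr.
by rewrite lebesgue_measure_itv/= lte01 sube0 ltry.
Qed.

HB.instance Definition _ := @Measure_isFinite.Build _ _ _
  (riesz_partial ha l N) riesz_partial_fin.

End instances.

(* Weak limits of finite measures are unique, so this determines [mu]; the limit
   exists as soon as [3 * l j <= l j.+1] for all j >= 1. *)
Definition is_riesz_product a (ha : forall j, -1 <= a j <= 1) l
    (mu : {finite_measure set (measurableTypeR R) -> \bar R}) : Prop :=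
  mu (~` `[0%R, 1%R]%classic) = 0%E /\ weak_cvg (fun N => riesz_partial ha l N) mu.

End RieszProduct.

Arguments is_riesz_product {R} a ha l mu.

Section FourierSpectrum.
Context {R : realType}.
Implicit Types (mu : {finite_measure set (measurableTypeR R) -> \bar R}).

Definition expi (t : R) : R[i] := Complex (cos t) (sin t).

Definition Cintegral mu (f : R -> R[i]) : R[i] :=
  Complex (\int[mu]_x complex.Re (f x)) (\int[mu]_x complex.Im (f x)).

Definition fourier mu (z : R) : R[i] :=
  Cintegral mu (fun x => expi (- (2 * pi * z * x))).

(* The modulus is [Normc.normc], with values in [R], whereas [`|_|] on [R[i]]
   takes values in [R[i]]. *)
Definition fourier_energy (s theta : R) mu : \bar R :=
  if theta == 0 then
    ereal_sup [set (Normc.normc (fourier mu z) ^+ 2 * `|z| `^ s)%:E | z in [set: R]]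
  else
    ((\int[lebesgue_measure]_z
        (Normc.normc (fourier mu z) `^ (2 / theta)
          * `|z| `^ (s / theta - 1))%:E) `^ theta)%E.

(* Adjoining 0, a lower bound of the set, implements [sup set0 = 0]. *)
Definition fourier_spectrum (theta : R) mu : \bar R :=
  ereal_sup (0%E |`
    [set s%:E | s in [set s : R | 0 <= s /\ (fourier_energy s theta mu < +oo)%E]]).

End FourierSpectrum.

(* Main.v *)
Require Import Defs.
From HB Require Import structures.
From mathcomp Require Import all_boot all_order all_algebra.
From mathcomp Require Import all_classical all_reals all_analysis.
From mathcomp Require Import measurable_realfun complex.
From mathcomp Require Import zify ring lra.

Set Implicit Arguments.
Unset Strict Implicit.
Unset Printing Implicit Defensive.
Import Order.TTheory GRing.Theory Num.Theory.
Import numFieldNormedType.Exports.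

Local Open Scope classical_set_scope.
Local Open Scope ring_scope.

(**
Write [p = 2 / theta] and [D = 1 + 2 * |a / 2| ^ p]. Expanding the product, the
Fourier coefficients of [mu] up to level [N] are [(a / 2) ^ k] at the integers
[n = sum_j e_j * lambda ^ j], [e_j] in {-1, 0, 1}, with [k] nonzero digits; these
integers are distinct because [lambda >= 3], and the [p]-th powers of the
coefficients add up to [D ^ N] over a window of length about [lambda ^ N]. So the
energy integral should converge exactly for exponents of [|z|] below
[- ln D / ln lambda]. What remains is to pass between sums over integers and
integrals over the line.

Divergence: for each [w] in [[0, 1/8]], the frequencies shifted by [w] are tested
against a second Riesz product [rho] with coefficient [2 sg(a) |a / 2| ^ (p - 1)]:
[sum_n rho^(n) Re mu^(n + w)] is the integral of [rho(x) cos(2 pi w x)] against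
[mu], which is at least [cos 1] times the integral of [rho], equal to [D ^ N]. By
Young's inequality [sum_n |mu^(n + w)| ^ p >= c D ^ N], and one integrates in [w].

Convergence: [mu^] is the limit of the transforms of the partial products, which
are bounded by [sum_n |c_n| / (1 + |n - z|)]; a weighted Jensen inequality turns
the [p]-th power into [sum_n |c_n| ^ p (1 + |n - z|) ^ (ep - 1)], and integrating
against [|z| ^ (- b)] leaves [sum_n |c_n| ^ p (1 + |n|) ^ (- de)], a geometric
series of ratio [D * lambda ^ (- de) < 1]. The losses [ep] and [b - de] are
affordable because the exponent is strictly subcritical.
*)

(** * Frequencies of the expanded Riesz product *)

(* The pairs [(k, n)] run over the sums [n] of [e_j * lambda ^ j] with
   [e_j] in {-1, 0, 1} and 1 <= j <= N; [k] is the number of nonzero [e_j]. *)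
Fixpoint riesz_terms (lambda N : nat) : seq (nat * int) :=
  if N is N'.+1 then
    let s := riesz_terms lambda N' in
    s ++ [seq (u.1.+1, u.2 + (lambda ^ N)%N%:Z) | u <- s]
      ++ [seq (u.1.+1, u.2 - (lambda ^ N)%N%:Z) | u <- s]
  else [:: (0%N, 0)].

Lemma big_riesz_termsS (V : nmodType) (F : nat * int -> V) l N :
  \sum_(u <- riesz_terms l N.+1) F u =
  \sum_(u <- riesz_terms l N)
    (F u + (F (u.1.+1, u.2 + (l ^ N.+1)%N%:Z)
            + F (u.1.+1, u.2 - (l ^ N.+1)%N%:Z))).
Proof. by rewrite /= !big_cat/= !big_map !big_split. Qed.

(** With [q = l ^ N.+1], a shift by [q] or [- q] turns 2|n| < q into 2|n| < 3q, and 3q is at most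
    [l ^ N.+2]. The factor 2 is what later keeps shifted copies apart. *)
Lemma riesz_terms_lt l N u : (3 <= l)%N -> u \in riesz_terms l N ->
  (2 * absz u.2 < l ^ N.+1)%N.
Proof.
move=> l3; elim: N u => [|N IH] u /=.
  by rewrite inE => /eqP ->/=; rewrite expn1; lia.
have h : (3 * l ^ N.+1 <= l ^ N.+2)%N by rewrite [leqRHS]expnS leq_mul2r l3 orbT.
rewrite !mem_cat => /or3P[/IH|/mapP[v /IH + ->]|/mapP[v /IH + ->]] /=;
  move: h; set q := (l ^ N.+1)%N; set q' := (l ^ N.+2)%N.
- lia.
- by move: (v.2 : int) => n; lia.
- by move: (v.2 : int) => n; lia.
Qed.

(** The three blocks of a new level lie within distance q/2 of 0, q and -q respectively, where
    [q = l ^ N.+1], so they cannot meet. *)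
Lemma riesz_terms_uniq l N : (3 <= l)%N -> uniq (map snd (riesz_terms l N)).
Proof.
move=> l3; elim: N => [//|N IH] /=.
rewrite !map_cat -!map_comp.
have E (c : int) : [seq (snd \o (fun u : nat * int => (u.1.+1, u.2 + c))) i
    | i <- riesz_terms l N] = [seq n + c | n <- map snd (riesz_terms l N)].
  by rewrite -map_comp.
have I (c : int) : injective (fun n : int => n + c) by exact: addIr.
rewrite !E !cat_uniq IH (map_inj_uniq (I _)) (map_inj_uniq (I _)) IH.
rewrite andbT/=; apply/andP; split.
  apply/hasPn => n; rewrite mem_cat => /orP[]
    /mapP[_ /mapP[u /(riesz_terms_lt l3) hu ->] ->];
    apply/negP => /mapP[v /(riesz_terms_lt l3)];
    by move: (u.2 : int) (v.2 : int) hu => m n' hu hv; lia.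
apply/hasPn => _ /mapP[_ /mapP[u /(riesz_terms_lt l3) hu ->] ->].
apply/negP => /mapP[_ /mapP[v /(riesz_terms_lt l3) hv ->]].
by move: (u.2 : int) (v.2 : int) hu hv => m n; lia.
Qed.

(** The gap at 1 ensures that a nonzero frequency stays at distance at least 1 from the origin after
    a shift by at most 1/8. *)
Lemma riesz_terms_neq0 l N u : (3 <= l)%N -> u \in riesz_terms l N ->
  u.2 != 0 -> (2 <= absz u.2)%N.
Proof.
move=> l3; elim: N u => [|N IH] u /=; first by rewrite inE => /eqP ->.
have h : (3 <= l ^ N.+1)%N.
  by rewrite expnS -[leqLHS]muln1 leq_mul// expn_gt0; lia.
rewrite !mem_cat => /or3P[/IH//| |] /mapP[v /(riesz_terms_lt l3) hv ->]/= _;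
  by move: (v.2 : int) hv => n; lia.
Qed.

(** * Expansion of trigonometric products into cosine sums *)

Section trigonometric_sums.
Context {R : realType}.
Implicit Types (a x : R) (l N : nat).

(** Each digit contributes independently: 1 for the value 0 and [x] for each of the two nonzero
    values. *)
Lemma sum_riesz_terms x l N :
  \sum_(u <- riesz_terms l N) x ^+ u.1 = (1 + 2 * x) ^+ N.
Proof.
elim: N => [|N IH]; first by rewrite big_seq1 !expr0.
rewrite big_riesz_termsS exprSr -IH mulr_suml; apply: eq_bigr => u _ /=.
by rewrite exprSr; ring.
Qed.

(** The phase [B] is free so that the induction closes: a new factor cos [th] splits [B] into
    [B + th] and [B - th]. It also lets one identity serve both sines and cosines. *)
Lemma riesz_density_cos a l N (x B : R) :
  riesz_density (fun=> a) (fun j => l ^ j)%N N x * cos B =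
  \sum_(u <- riesz_terms l N) (a / 2) ^+ u.1 * cos (B + 2 * pi * u.2%:~R * x).
Proof.
elim: N B => [|N IH] B.
  by rewrite /riesz_density big_geq//= big_seq1/= mulr0 mul0r addr0.
rewrite /riesz_density big_nat_recr//= -/(riesz_density _ _ _ _).
set th := 2 * pi * _ * x.
have -> : riesz_density (fun=> a) (fun j => l ^ j)%N N x * (1 + a * cos th) * cos B
  = riesz_density (fun=> a) (fun j => l ^ j)%N N x * cos B
  + a / 2 * (riesz_density (fun=> a) (fun j => l ^ j)%N N x * cos (B + th)
     + riesz_density (fun=> a) (fun j => l ^ j)%N N x * cos (B - th)).
  by rewrite cosD cosB; field.
rewrite -[(_ ++ _ ++ _)%SEQ]/(riesz_terms l N.+1) big_riesz_termsS !IH.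
rewrite -big_split mulr_sumr -big_split.
apply: eq_bigr => u _ /=; rewrite exprSr intrB intrD.
have -> : B + 2 * pi * (u.2%:~R + (l ^ N.+1)%N%:~R) * x =
  B + th + 2 * pi * u.2%:~R * x by rewrite /th -pmulrn; ring.
have -> : B + 2 * pi * (u.2%:~R - (l ^ N.+1)%N%:~R) * x =
  B - th + 2 * pi * u.2%:~R * x by rewrite /th -pmulrn; ring.
by ring.
Qed.

(** Second harmonics are included because the product of two Riesz products with the same
    frequencies creates squares of cosines. Lacunarity makes the zero frequency arise only from the
    constants [al j]. *)
Lemma trig_product_expansion l N (al be ga : nat -> R) : (3 <= l)%N ->
  exists L : seq (R * int),
  [/\ forall x, \prod_(1 <= j < N.+1)
        (al j + be j * cos (2 * pi * (l ^ j)%:R * x)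
              + ga j * cos (2 * (2 * pi * (l ^ j)%:R * x)))
        = \sum_(u <- L) u.1 * cos (2 * pi * u.2%:~R * x),
      {in L, forall u, (absz u.2 < l ^ N.+1)%N} &
      \sum_(u <- L | u.2 == 0) u.1 = \prod_(1 <= j < N.+1) al j].
Proof.
move=> l3; elim: N => [|N [L [LE Lb L0]]].
  exists [:: (1, 0)]; split.
  - by move=> x; rewrite big_geq// big_seq1/= mulr0 mul0r cos0 mulr1.
  - by move=> u; rewrite inE => /eqP ->/=; rewrite expn1; lia.
  - by rewrite big_geq// big_cons big_nil/= addr0.
set q := (l ^ N.+1)%N in Lb *; set c := N.+1.
have q3 : (3 * q <= l ^ N.+2)%N by rewrite [leqRHS]expnS leq_mul2r l3 orbT.
have q1 : (1 <= q)%N by rewrite expn_gt0; lia.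
pose T (f : R) (d : int) := [seq (u.1 * f, u.2 + d) | u <- L].
(* Five shifted copies of [L]: by 0 for the mean, by q and -q for the cosine, by 2q and -2q for its
   double. *)
exists (T (al c) 0 ++ (T (be c / 2) q%:Z ++ T (be c / 2) (- q%:Z)) ++
  (T (ga c / 2) (2 * q)%N%:Z ++ T (ga c / 2) (- (2 * q)%N%:Z))); split.
- move=> x; rewrite big_nat_recr//= -/c LE !big_cat/= !big_map.
  rewrite mulr_suml -!big_split/=; apply: eq_bigr => u _ /=.
  rewrite !intrD !intrN; set th := 2 * pi * q%:R * x.
  have -> : 2 * pi * (u.2%:~R + 0%:~R) * x = 2 * pi * u.2%:~R * x.
    by rewrite addr0.
  have -> : 2 * pi * (u.2%:~R + q%:~R) * x = 2 * pi * u.2%:~R * x + th.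
    by rewrite /th -pmulrn; ring.
  have -> : 2 * pi * (u.2%:~R - q%:~R) * x = 2 * pi * u.2%:~R * x - th.
    by rewrite /th -pmulrn; ring.
  have -> : 2 * pi * (u.2%:~R + (2 * q)%N%:~R) * x = 2 * pi * u.2%:~R * x + 2 * th.
    by rewrite /th -pmulrn natrM; ring.
  have -> : 2 * pi * (u.2%:~R - (2 * q)%N%:~R) * x = 2 * pi * u.2%:~R * x - 2 * th.
    by rewrite /th -pmulrn natrM; ring.
  by rewrite !cosD !cosN !sinN; field.
- move=> u; rewrite !mem_cat => /orP[|/orP[/orP[]|/orP[]]] /mapP[v /Lb hv ->]/=;
    by move: (v.2 : int) hv => n hv; move: q3; rewrite -/c; set q2 := (l ^ c.+1)%N; lia.
(* Since |n| < q in [L], a shift of modulus at least q never lands on 0; only the unshifted copy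
   contributes. *)
- have Z (f : R) (d : int) : (q <= absz d)%N -> \sum_(u <- T f d | u.2 == 0) u.1 = 0.
    move=> dq; rewrite big_map big_seq_cond big_pred0// => u.
    by apply/negP => /andP[/Lb] /=; move: (u.2 : int) => n; lia.
  rewrite !big_cat/= !(Z (be c / 2)) ?(Z (ga c / 2)) ?addr0//; try lia.
  rewrite big_map/= big_nat_recr//= -L0 mulr_suml.
  by apply: eq_bigl => u; rewrite addr0.
Qed.

End trigonometric_sums.

(** * Integrals of cosines over the unit interval *)

Section integrals_over_unit_interval.
Context {R : realType}.
Local Notation leb := (@lebesgue_measure R).
Local Notation I01 := (`[0%R, 1%R]%classic : set R).

Lemma continuous_cos_affine (B w : R) : continuous (fun x : R => cos (B + w * x)).
Proof.
move=> x; apply: continuous_comp; last exact: continuous_cos.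
by apply: cvgD; [exact: cvg_cst|apply: cvgM; [exact: cvg_cst|exact: cvg_id]].
Qed.

Lemma continuous_cosM (w : R) : continuous (fun x => cos (w * x)).
Proof.
move=> x; apply: continuous_comp; last exact: continuous_cos.
by apply: cvgM; [exact: cvg_cst|exact: cvg_id].
Qed.

Lemma integrable_unit_continuous (f : R -> R) : continuous f ->
  leb.-integrable I01 (EFin \o f).
Proof.
move=> cf; apply: continuous_compact_integrable; first exact: segment_compact.
exact: continuous_subspaceT.
Qed.

Lemma Rintegral_unit_sum (I : eqType) (s : seq I) (f : I -> R -> R) :
  (forall i, continuous (f i)) ->
  \int[leb]_(x in I01) (\sum_(i <- s) f i x) =
  \sum_(i <- s) \int[leb]_(x in I01) f i x.
Proof.
move=> cf; elim: s => [|i s IH].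
  by rewrite big_nil; under eq_Rintegral do rewrite big_nil;
    rewrite Rintegral_cst// mul0r.
rewrite big_cons -IH; under eq_Rintegral do rewrite big_cons.
apply: RintegralD => //; apply: integrable_unit_continuous => //.
by apply: continuous_big => // ?; exact: add_continuous.
Qed.

Lemma Rintegral_unitZl (c : R) (f : R -> R) : continuous f ->
  \int[leb]_(x in I01) (c * f x) = c * \int[leb]_(x in I01) f x.
Proof. by move=> cf; apply: RintegralZl => //; exact: integrable_unit_continuous. Qed.

Lemma integral_cosE (B w : R) : w != 0 ->
  \int[leb]_(x in I01) cos (B + w * x) = (sin (B + w) - sin B) / w.
Proof.
move=> w0; rewrite /Rintegral.
have D (x : R) : is_derive x 1 (fun x => sin (B + w * x) / w) (cos (B + w * x)).
  rewrite (_ : (fun x => _) = w^-1 *: (sin \o (cst B + w *: id))); last first.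
    by apply/funext => y /=; rewrite mulrC.
  have A : is_derive x 1 (cst B + w *: (@id R)) w.
    have : is_derive x 1 (cst B + w *: (@id R)) (0 + w *: (1 : R)).
      exact: is_deriveD.
    by rewrite add0r (_ : w *: (1 : R) = w)//; exact: mulr1.
  have S : is_derive x 1 (sin \o (cst B + w *: id)) (cos (B + w * x) * w).
    exact: is_derive1_comp.
  by apply: is_derive_eq; rewrite /GRing.scale/=; field.
rewrite (@continuous_FTC2 _ _ (fun x => sin (B + w * x) / w)) ?ltr01//=.
- by rewrite mulr0 addr0 mulr1 mulrBl.
- apply: continuous_subspaceT; exact: continuous_cos_affine.
- have cF : continuous (fun x => sin (B + w * x) / w).
    by move=> x; apply/differentiable_continuous/derivable1_diffP; case: (D x).
  split.
  + by move=> x _; case: (D x).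
  + by apply: cvg_at_right_filter; exact: cF.
  + by apply: cvg_at_left_filter; exact: cF.
- by move=> x _; rewrite derive1E; case: (D x).
Qed.

(** For |w| at most 1 the trivial bound 1 suffices. Otherwise the primitive gives at most 1 / (pi
    |w|), and 1 + |w| < 2 pi |w|. *)
Lemma integral_cos_le (B w : R) :
  `|\int[leb]_(x in I01) cos (B + 2 * pi * w * x)| <= 2 / (1 + `|w|).
Proof.
have w0 : 0 < 1 + `|w| by rewrite ltr_wpDr.
have [w1|w1] := leP `|w| 1.
  apply: (@le_trans _ _ 1); last first.
    by rewrite ler_pdivlMr// mul1r -[2]/(1 + 1) lerD2l.
  apply: le_trans (le_normr_Rintegral _ _) _ => //.
    exact/integrable_unit_continuous/continuous_cos_affine.
  apply: (@le_trans _ _ (\int[leb]_(x in I01) 1)).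
    apply: le_Rintegral => //.
    + apply: integrable_unit_continuous => x.
      by apply: cvg_norm; exact: continuous_cos_affine.
    + by apply: integrable_unit_continuous => x; exact: cvg_cst.
    + by move=> x _; rewrite cos_max.
  by rewrite Rintegral_cst//= lebesgue_measure_itv/= lte01 sube0 mul1r.
have wn0 : w != 0 by rewrite -normr_gt0 (lt_trans _ w1).
have p2 : (0 : R) < 2 * pi by rewrite mulr_gt0// pi_gt0.
rewrite integral_cosE; last by rewrite mulf_eq0 negb_or wn0 gt_eqF.
rewrite normrM normfV normrM (gtr0_norm p2).
rewrite ler_pdivlMr// mulrAC ler_pdivrMr; last by rewrite mulr_gt0// (lt_trans _ w1).
have s2 : `|sin (B + 2 * pi * w) - sin B| <= 2.
  by rewrite (le_trans (ler_normB _ _))// -[leRHS]/(1 + 1) lerD// sin_max.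
have := @pi_ge2 R => pi2.
apply: (@le_trans _ _ (2 * (1 + `|w|))); first by rewrite ler_wpM2r// ltW.
by nra.
Qed.

Lemma sin_pi_int (n : int) : sin (2 * pi * n%:~R) = 0 :> R.
Proof.
have S (m : nat) : sin (2 * pi * m%:R) = 0 :> R.
  have -> : 2 * pi * m%:R = 0 + (pi *+ 2) *+ m :> R.
    by rewrite add0r -mulr_natr -(mulr_natr pi); ring.
  by rewrite periodicn ?sin0//; exact: sinD2pi.
by case: n => m; rewrite ?NegzE ?mulrNz ?mulrN ?sinN -?pmulrn S ?oppr0.
Qed.

Lemma integral_cos_int (n : int) :
  \int[leb]_(x in I01) cos (2 * pi * n%:~R * x) = (n == 0)%:R.
Proof.
have [->|n0] := eqVneq.
  under eq_Rintegral do rewrite mulr0 mul0r cos0.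
  by rewrite Rintegral_cst//= lebesgue_measure_itv/= lte01 sube0 mul1r.
under eq_Rintegral do rewrite -[_ * _ * _]add0r.
rewrite integral_cosE ?add0r ?sin_pi_int ?sin0 ?subr0 ?mul0r//.
by rewrite mulf_eq0 negb_or intr_eq0 n0 andbT gt_eqF// mulr_gt0// pi_gt0.
Qed.

(** Only the zero frequency survives integration, so the factors behave like independent random
    variables of means [al j]. *)
Lemma integral_trig_product (l N : nat) (al be ga : nat -> R) : (3 <= l)%N ->
  \int[leb]_(x in I01) (\prod_(1 <= j < N.+1)
        (al j + be j * cos (2 * pi * (l ^ j)%:R * x)
              + ga j * cos (2 * (2 * pi * (l ^ j)%:R * x))))
  = \prod_(1 <= j < N.+1) al j.
Proof.
move=> l3; have [L [LE _ <-]] := trig_product_expansion N al be ga l3.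
under eq_Rintegral do rewrite LE.
rewrite Rintegral_unit_sum => [|u x]; last first.
  by apply: cvgM; [exact: cvg_cst|exact: continuous_cosM].
rewrite [RHS]big_mkcond; apply: eq_bigr => u _.
rewrite Rintegral_unitZl; last exact: continuous_cosM.
by rewrite integral_cos_int; case: ifP; rewrite ?mulr1 ?mulr0.
Qed.

End integrals_over_unit_interval.

(** * Measures given by a density *)

(** The Radon-Nikodym derivative of [nu] agrees almost everywhere with [rho] cut off outside [D],
    both having the same integral over every measurable set. *)
Lemma integral_density d (T : measurableType d) (R : realType)
    (nu : {finite_measure set T -> \bar R})
    (la : {sigma_finite_measure set T -> \bar R}) (D : set T) (rho : T -> R)
    (f : T -> \bar R) :
  measurable D -> measurable_fun [set: T] rho ->
  (forall A, measurable A -> nu A = \int[la]_(x in A `&` D) (rho x)%:E)%E ->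
  nu.-integrable [set: T] f ->
  (\int[nu]_x f x = \int[la]_(x in D) (f x * (rho x)%:E))%E.
Proof.
move=> mD mrho nuE fi.
have numu : nu `<< la.
  apply/null_content_dominatesP => A mA A0; rewrite nuE//.
  have mAD : measurable (A `&` D) by exact: measurableI.
  apply: null_set_integral => //; first exact/measurable_EFinP/measurable_funTS.
  by apply/eqP; rewrite eq_le measure_ge0 andbT -A0 le_measure ?inE//; exact: subIsetl.
have mg : measurable_fun [set: T] ((EFin \o rho) \_ D).
  by apply/(measurable_restrictT _ mD).1; apply: measurable_funTS;
    apply/measurable_EFinP.
have ag : ae_eq la [set: T]
    (Radon_Nikodym (charge_of_finite_measure nu) la) ((EFin \o rho) \_ D).
  apply: integral_ae_eq => //.
  - exact: Radon_Nikodym_integrable.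
  - move=> E _ mE; transitivity (nu E); first by rewrite -Radon_Nikodym_integral.
    by rewrite nuE// integral_mkcondr.
rewrite -(Radon_Nikodym_change_of_variables numu measurableT fi).
have mf := measurable_int _ fi.
transitivity (\int[la]_x (f x * ((EFin \o rho) \_ D) x))%E.
  apply: ae_eq_integral => //.
  - apply: emeasurable_funM => //; apply: (measurable_int la);
    exact: Radon_Nikodym_integrable.
  - exact: emeasurable_funM.
  - exact: ae_eqe_mul2l.
rewrite [RHS]integral_mkcond; apply: eq_integral => x _.
by rewrite !patchE; case: ifP => //; rewrite mule0.
Qed.

(** * Translation invariance and sums over integer shifts *)

Section translation.
Context {R : realType}.
Local Notation leb := (@lebesgue_measure R).
Local Open Scope ereal_scope.

Lemma lebesgue_measure_shift (c : R) (A : set R) : measurable A ->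
  pushforward leb
    ((fun x => x + c)%R : measurableTypeR R -> measurableTypeR R) A = leb A.
Proof.
have m : measurable_fun setT
    ((fun x => x + c)%R : measurableTypeR R -> measurableTypeR R).
  exact: measurable_funD.
move=> mA; apply/esym/lebesgue_measure_unique => //= _ [[a b]] _ <-.
rewrite /pushforward.
have -> : (fun x => x + c)%R @^-1` `]a, b]%classic = `](a - c)%R, (b - c)%R]%classic.
  by apply/seteqP; split => x /=; rewrite !in_itv/= ltrBlDr lerBrDr.
rewrite !lebesgue_measure_itv/= !lte_fin ltrD2r.
by case: ifP => // _; rewrite -!EFinB; congr EFin; lra.
Qed.

Lemma ge0_integral_shift (c : R) (D : set R) (f : R -> \bar R) : measurable D ->
  measurable_fun setT f -> (forall x, 0 <= f x) ->
  \int[leb]_(x in (fun x => x + c)%R @^-1` D) f (x + c)%R = \int[leb]_(x in D) f x.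
Proof.
move=> mD mf f0.
have m : measurable_fun setT
    ((fun x => x + c)%R : measurableTypeR R -> measurableTypeR R).
  exact: measurable_funD.
rewrite -[LHS](@ge0_integral_pushforward _ _ _ _ R _ m leb D f)//; last first.
  exact: measurable_funTS.
by apply: eq_measure_integral => //= A mA AS; exact: lebesgue_measure_shift.
Qed.

(** Distinct integers give disjoint intervals [n, n + 1[. This is the passage from sums over
    frequencies to integrals over the line. *)
Lemma sum_integral_shift_le (S : seq int) (f : R -> \bar R) : uniq S ->
  measurable_fun setT f -> (forall x, 0 <= f x) ->
  \sum_(n <- S) \int[leb]_(w in `[0%R, 1%R[) f (n%:~R + w)%R <= \int[leb]_x f x.
Proof.
move=> uS mf f0.
have E (n : int) : \int[leb]_(w in `[0%R, 1%R[) f (n%:~R + w)%R =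
    \int[leb]_(x in `[n%:~R, (n%:~R + 1)%R[) f x.
  rewrite -[RHS](ge0_integral_shift n%:~R)//.
  rewrite [X in _ = integral _ X _](_ : _ = `[0%R, 1%R[%classic); last first.
    by apply/seteqP; split => x /=; rewrite !in_itv/= lerDr (addrC x) ltrD2l.
  by apply: eq_integral => x _; rewrite addrC.
under eq_bigr do rewrite E.
rewrite -(@ge0_integral_bigsetU _ _ _ leb _
  (fun n : int => `[n%:~R, (n%:~R + 1)%R[%classic))//.
- apply: ge0_subset_integral => //.
  by apply: bigsetU_measurable => n _.
- apply/trivIsetP => i j _ _ ij; apply/seteqP; split => // x/= [].
  rewrite !in_itv/= => /andP[ix xi] /andP[jx xj].
  have : (i%:~R < j%:~R + 1 :> R)%R by lra.
  have : (j%:~R < i%:~R + 1 :> R)%R by lra.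
  rewrite -!(intrD _ _ 1) !ltr_int; lia.
- exact: measurable_funTS.
Qed.

End translation.

(** * Integrability by layers *)

Section layers.
Context {R : realType}.
Local Notation leb := (@lebesgue_measure R).

(** The function is dominated by the sum of the heights [a k] times the indicators of ]-r k, r k[,
    whose integral is at most [2 * H]. *)
Lemma integral_layers_lty (f : R -> R) (a r : nat -> R) (H : R) :
  measurable_fun setT f -> (forall x, 0 <= f x) ->
  (forall k, 0 <= a k) -> (forall k, 0 <= r k) ->
  (forall x, f x != 0 -> exists2 k, f x <= a k & `|x| < r k) ->
  (forall K, \sum_(0 <= k < K) a k * r k <= H) ->
  (\int[leb]_x (f x)%:E < +oo)%E.
Proof.
move=> mf f0 a0 r0 fle HH.
pose A k : set R := `]- r k, r k[%classic.
pose g k x := (a k * \1_(A k) x)%:E.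
have g0 k x : (0 <= g k x)%E by rewrite lee_fin mulr_ge0.
have mA k : measurable (A k) by exact: measurable_itv.
have mg k : measurable_fun setT (g k).
  by apply/measurable_EFinP; apply: measurable_funM => //; exact: measurable_indic.
have gE k : (\int[leb]_x g k x = (a k * (2 * r k))%:E)%E.
  rewrite /g; under eq_integral do rewrite EFinM.
  have mi : measurable_fun [set: measurableTypeR R] (fun x => (\1_(A k) x)%:E : \bar R).
    by apply/measurable_EFinP; apply: measurable_indic; exact: mA.
  rewrite (ge0_integralZl leb measurableT mi) ?lee_fin//.
  rewrite integral_indic//= ; last exact: mA.
  have -> : leb (A k `&` setT) = leb (A k) by congr (leb _); exact: setIT.
  rewrite /A lebesgue_measure_itv/= lte_fin.
  case: ifPn => [_|]; first by rewrite -EFinB -EFinM; congr EFin; ring.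
  rewrite -leNgt => h; have -> : r k = 0 by apply/eqP; rewrite eq_le r0 andbT; lra.
  by rewrite !mulr0 mule0.
apply: (@le_lt_trans _ _ (\int[leb]_x (\sum_(k <oo) g k x))%E).
  apply: ge0_le_integral => //.
  - by move=> x _; rewrite lee_fin.
  - exact/measurable_EFinP.
  - by apply: ge0_emeasurable_sum => // k _; exact: mg.
  move=> x _; have [->|/fle[k fk xk]] := eqVneq (f x) 0; first exact: nneseries_ge0.
  apply: (@le_trans _ _ (\sum_(0 <= i < k.+1) g i x)%E); last first.
    by apply: nneseries_lim_ge.
  rewrite big_nat_recr//=; apply: (@le_trans _ _ (g k x)); last first.
    by rewrite leeDr// sume_ge0.
  by rewrite lee_fin /g indicE mem_set ?mulr1// /A /= in_itv/= -ltr_norml.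
rewrite integral_nneseries//; apply: (@le_lt_trans _ _ (2 * H)%:E); last exact: ltry.
apply: lime_le.
  by apply: is_cvg_nneseries => n _ _; exact: integral_ge0.
apply: nearW => K; under eq_bigr do rewrite gE.
rewrite sumEFin lee_fin (le_trans _ (ler_wpM2l _ (HH K)))// mulr_sumr.
by rewrite ler_sum// => i _; rewrite mulrCA.
Qed.

End layers.

(** * Weak limits tested against continuous bounded functions *)

Section riesz_limit.
Context {R : realType}.
Local Notation leb := (@lebesgue_measure R).
Local Notation I01 := (`[0%R, 1%R]%classic : set R).
Variable mu : {finite_measure set (measurableTypeR R) -> \bar R}.

Lemma bounded_setT (f : R -> R) (C : R) : (forall x, `|f x| <= C) ->
  [bounded f x | x in [set: R]].
Proof.
move=> fC; exists C; split; first exact: num_real.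
by move=> M CM x _; exact: le_trans (fC x) (ltW CM).
Qed.

Lemma integrable_continuous_bounded
    (nu : {finite_measure set (measurableTypeR R) -> \bar R})
    (f : R -> R) (C : R) : continuous f ->
  (forall x, `|f x| <= C) -> nu.-integrable [set: R] (EFin \o f).
Proof.
move=> cf fC; apply: measurable_bounded_integrable => //.
- by rewrite ltey_eq fin_num_measure.
- exact: continuous_measurable_fun.
- exact: bounded_setT fC.
Qed.

Lemma cvg_riesz_integral (a : nat -> R) ha l (f : R -> R) (C : R) :
  is_riesz_product a ha l mu -> continuous f -> (forall x, `|f x| <= C) ->
  \int[leb]_(x in I01) (f x * riesz_density a l N x) @[N --> \oo]
    --> \int[mu]_x f x.
Proof.
move=> [_ W] cf fC.
have /fineK h := integrable_fin_num measurableT (integrable_continuous_bounded mu cf fC).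
have := W f cf (bounded_setT fC).
rewrite -h => /fine_cvg; apply: cvg_trans; apply: near_eq_cvg; apply: nearW => N /=.
rewrite (@integral_density _ _ _ _ leb I01 (riesz_density a l N))//.
- exact: measurable_riesz_density.
- exact: integrable_continuous_bounded.
Qed.

End riesz_limit.

(** * Size and measurability of the Fourier transform *)

Section fourier_bounds.
Context {R : realType}.
Variable mu : {finite_measure set (measurableTypeR R) -> \bar R}.

Lemma normc_ge_normRe (z : R[i]) : `|complex.Re z| <= Normc.normc z.
Proof.
by case: z => x y /=; rewrite -sqrtr_sqr ler_wsqrtr// lerDl sqr_ge0.
Qed.

Lemma normc_le_ReIm (z : R[i]) :
  Normc.normc z <= `|complex.Re z| + `|complex.Im z|.
Proof.
case: z => x y /=; rewrite -[leRHS]ger0_norm ?addr_ge0// -sqrtr_sqr.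
rewrite ler_wsqrtr// sqrrD !real_normK ?num_real//.
by rewrite [leRHS]addrAC lerDl mulrn_wge0// mulr_ge0.
Qed.

Lemma continuous_sinM (w : R) : continuous (fun x => sin (w * x)).
Proof.
move=> x; apply: continuous_comp; last exact: continuous_sin.
by apply: cvgM; [exact: cvg_cst|exact: cvg_id].
Qed.

Lemma Re_fourier (z : R) :
  complex.Re (fourier mu z) = \int[mu]_x cos (- (2 * pi * z) * x).
Proof. by apply: eq_Rintegral => x _; rewrite /expi /= mulNr. Qed.

Lemma Im_fourier (z : R) :
  complex.Im (fourier mu z) = \int[mu]_x sin (- (2 * pi * z) * x).
Proof. by apply: eq_Rintegral => x _; rewrite /expi /= mulNr. Qed.

Lemma Rintegral_le_mass (f : R -> R) : continuous f -> (forall x, `|f x| <= 1) ->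
  `|\int[mu]_x f x| <= fine (mu setT).
Proof.
move=> cf f1; have fi := integrable_continuous_bounded mu cf f1.
apply: le_trans (le_normr_Rintegral _ fi) _ => //.
rewrite -[leRHS]mul1r -Rintegral_cst//; apply: le_Rintegral => //.
- exact: integrable_norm.
- exact: finite_measure_integrable_cst.
Qed.

Lemma normc_fourier_le_mass (z : R) :
  Normc.normc (fourier mu z) <= 2 * fine (mu setT).
Proof.
rewrite (le_trans (normc_le_ReIm _))// mulr_natl mulr2n Re_fourier Im_fourier.
apply: lerD; apply: Rintegral_le_mass => [|x]; rewrite ?cos_max ?sin_max//.
- exact: continuous_cosM.
- exact: continuous_sinM.
Qed.

Let measurable_Rintegral (g : R -> R) : continuous g -> (forall x, `|g x| <= 1) ->
  measurable_fun setT (fun z : R => \int[mu]_x g (- (2 * pi * z) * x)).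
Proof.
move=> cg g1.
have cgz (z : R) : continuous (fun x => g (- (2 * pi * z) * x)).
  move=> x; apply: continuous_comp; last exact: cg.
  by apply: cvgM; [exact: cvg_cst|exact: cvg_id].
(* Adding 1 makes the integrand nonnegative, as Tonelli requires; the total mass is subtracted again
   below. *)
pose f (p : R * R) := (1 + g (- (2 * pi * p.1) * p.2))%:E.
have f0 p : (0 <= f p)%E.
  by rewrite lee_fin; have := g1 (- (2 * pi * p.1) * p.2); rewrite ler_norml; lra.
have mf : measurable_fun [set: measurableTypeR R * measurableTypeR R] f.
  apply/measurable_EFinP; apply: measurable_funD => //.
  apply: measurableT_comp; first exact: continuous_measurable_fun.
  apply: measurable_funM => //; apply: measurableT_comp => //.
  exact: measurable_funM.
have := measurable_fun_fubini_tonelli_F (m2 := mu) f mf f0.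
rewrite /fubini_F /f/= => mF.
have {}mF := measurableT_comp (fine_measurable measurableT) mF.
rewrite (_ : (fun z => _) = (fun z =>
    \int[mu]_x (1 + g (- (2 * pi * z) * x)) - fine (mu setT))).
  exact: measurable_funB.
apply/funext => z; rewrite RintegralD//.
- by rewrite Rintegral_cst// mul1r addrAC subrr add0r.
- exact: finite_measure_integrable_cst.
- exact: integrable_continuous_bounded (cgz z) _.
Qed.

Lemma measurable_normc_fourier :
  measurable_fun [set: R] (fun z => Normc.normc (fourier mu z)).
Proof.
rewrite (_ : (fun z => _) = (fun z => Num.sqrt
  ((\int[mu]_x cos (- (2 * pi * z) * x)) ^+ 2
   + (\int[mu]_x sin (- (2 * pi * z) * x)) ^+ 2))); last first.
  by apply/funext => z; rewrite -Re_fourier -Im_fourier.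
apply: measurableT_comp.
  by apply: continuous_measurable_fun; exact: sqrt_continuous.
apply: measurable_funD; apply: measurable_funX;
  apply: measurable_Rintegral => [|x]; rewrite ?cos_max ?sin_max//.
- exact: continuous_cos.
- exact: continuous_sin.
Qed.

End fourier_bounds.

(** * Fourier transform of the Riesz product *)

Section riesz_product_fourier.
Context {R : realType}.
Local Notation leb := (@lebesgue_measure R).
Local Notation I01 := (`[0%R, 1%R]%classic : set R).
Variables (l : nat) (a : R) (mu : {finite_measure set (measurableTypeR R) -> \bar R}).
Hypotheses (l3 : (3 <= l)%N) (ha : -1 <= a <= 1).
Hypothesis mur : is_riesz_product (fun=> a) (fun=> ha) (fun j => (l ^ j)%N) mu.
Local Notation density b := (riesz_density (fun=> b) (fun j => (l ^ j)%N)).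

Lemma cos_double (t : R) : cos (2 * t) = 2 * cos t ^+ 2 - 1.
Proof. by rewrite mulr_natl cos_mulr2n; ring. Qed.

Lemma continuous_riesz_density (b : R) N : continuous (density b N).
Proof.
rewrite /riesz_density; apply: continuous_big => [|j _]; first exact: mul_continuous.
move=> x; apply: cvgD; first exact: cvg_cst.
by apply: cvgM; [exact: cvg_cst|exact: continuous_cosM].
Qed.

Lemma riesz_density_bound (b : R) N x : -1 <= b <= 1 ->
  `|density b N x| <= 2 ^+ N.
Proof.
move=> hb; rewrite ger0_norm; first exact: (riesz_density_le (fun=> hb)).
exact: (riesz_density_ge0 (fun=> hb)).
Qed.

Lemma cvg_Rintegral_eq (f : R -> R) (C c : R) N0 : continuous f ->
  (forall x, `|f x| <= C) ->
  (forall N, (N0 <= N)%N -> \int[leb]_(x in I01) (f x * density a N x) = c) ->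
  \int[mu]_x f x = c.
Proof.
move=> cf fC E; apply/esym/(cvg_unique _ _ (cvg_riesz_integral mur cf fC)) => //.
apply: cvg_near_cst; near=> N; apply: E; near: N; exact: nbhs_infty_ge.
Unshelve. all: by end_near. Qed.

Lemma big_nat_if_le (F : nat -> R) N M : (N <= M)%N ->
  \prod_(1 <= j < M.+1) (if (j <= N)%N then F j else 1) = \prod_(1 <= j < N.+1) F j.
Proof. by move=> NM; rewrite [RHS](big_nat_widen _ _ M.+1)// [RHS]big_mkcond. Qed.

(** Against [mu], each of the first [N] factors becomes (1 + a c)(1 + b c) with c a cosine, of mean
    [1 + a * b / 2]; the later factors have mean 1. *)
Lemma integral_riesz_density (b : R) N : -1 <= b <= 1 ->
  \int[mu]_x density b N x = (1 + a * b / 2) ^+ N.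
Proof.
move=> hb; apply: (@cvg_Rintegral_eq _ (2 ^+ N) _ N).
- exact: continuous_riesz_density.
- by move=> x; exact: riesz_density_bound.
move=> M NM.
(* Coefficients of (1 + a c)(1 + b c) after writing the square of c through the double angle; beyond
   level [N] only 1 + a c remains. *)
pose al (j : nat) := if (j <= N)%N then 1 + a * b / 2 else 1 : R.
pose be (j : nat) := if (j <= N)%N then a + b else a.
pose ga (j : nat) := if (j <= N)%N then a * b / 2 else 0 : R.
transitivity (\prod_(1 <= j < M.+1) al j).
  rewrite -(integral_trig_product M al be ga l3); apply: eq_Rintegral => x _.
  rewrite /riesz_density -(big_nat_if_le _ NM) -big_split/=; apply: eq_bigr => j _.
  rewrite /al /be /ga; case: ifP => _; last by ring.
  by rewrite cos_double; field.
by rewrite big_nat_if_le// prodr_const_nat subn1.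
Qed.

(** The test cosine interacts with the factor [j = N] alone, so the transform does not decay along
    the powers of [l]. *)
Lemma Re_fourier_power N : (1 <= N)%N -> complex.Re (fourier mu (l ^ N)%:R) = a / 2.
Proof.
move=> N1; rewrite Re_fourier.
apply: (@cvg_Rintegral_eq _ 1 _ N) => [|x|M NM]; rewrite ?cos_max//.
  exact: continuous_cosM.
pose al (j : nat) := if j == N then a / 2 else 1 : R.
pose be (j : nat) := if j == N then 1 else a : R.
pose ga (j : nat) := if j == N then a / 2 else 0 : R.
have NI : N \in index_iota 1 M.+1 by rewrite mem_index_iota N1.
transitivity (\prod_(1 <= j < M.+1) al j); last first.
  rewrite (bigD1_seq N) ?iota_uniq//= /al eqxx big1 ?mulr1// => j jN.
  by rewrite (negbTE jN).
rewrite -(integral_trig_product M al be ga l3); apply: eq_Rintegral => x _.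
rewrite /riesz_density mulNr cosN.
rewrite (bigD1_seq N) ?iota_uniq//= [RHS](bigD1_seq N) ?iota_uniq//= [LHS]mulrA.
congr (_ * _).
  by rewrite /al /be /ga eqxx cos_double; field.
by apply: eq_bigr => j jN; rewrite /al /be /ga (negbTE jN); ring.
Qed.

(** A bound on the partial products that is uniform in [N] passes to the weak limit. *)
Lemma normr_Rintegral_cos_le (B z C : R) :
  (forall N, \sum_(u <- riesz_terms l N)
     (`|a| / 2) ^+ u.1 * (2 / (1 + `|u.2%:~R - z|)) <= C) ->
  `|\int[mu]_x cos (B + - (2 * pi * z) * x)| <= C.
Proof.
move=> SC; have cc := @continuous_cos_affine R B (- (2 * pi * z)).
apply: (cvgr_to_le (cvg_norm (cvg_riesz_integral mur cc (fun x => cos_max _)))).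
apply: nearW => N; apply: le_trans (SC N).
have -> : \int[leb]_(x in I01) (cos (B + - (2 * pi * z) * x) * density a N x) =
    \int[leb]_(x in I01) (\sum_(u <- riesz_terms l N)
      (a / 2) ^+ u.1 * cos (B + 2 * pi * (u.2%:~R - z) * x)).
  apply: eq_Rintegral => x _; rewrite mulrC riesz_density_cos.
  by apply: eq_bigr => u _; congr (_ * cos _); ring.
have cu (n : int) := @continuous_cos_affine R B (2 * pi * (n%:~R - z)).
rewrite Rintegral_unit_sum => [|u x]; last by apply: cvgM; [exact: cvg_cst|exact: cu].
apply: le_trans (ler_norm_sum _ _ _) _; apply: ler_sum => u _.
rewrite Rintegral_unitZl; last exact: cu.
rewrite normrM normrX normrM normfV (ger0_norm (ler0n _ 2)).
by rewrite ler_wpM2l ?exprn_ge0 ?divr_ge0// integral_cos_le.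
Qed.

(** The phases 0 and [- (pi / 2)] give the real and the imaginary part, hence the factor 2. *)
Lemma normc_fourier_le (z C : R) :
  (forall N, \sum_(u <- riesz_terms l N)
     (`|a| / 2) ^+ u.1 * (2 / (1 + `|u.2%:~R - z|)) <= C) ->
  Normc.normc (fourier mu z) <= 2 * C.
Proof.
move=> SC; rewrite (le_trans (normc_le_ReIm _))// mulr_natl mulr2n lerD//.
  have := normr_Rintegral_cos_le 0 SC.
  by rewrite Re_fourier; under eq_Rintegral do rewrite add0r.
have := normr_Rintegral_cos_le (- (pi / 2)) SC.
by rewrite Im_fourier; under eq_Rintegral do rewrite addrC cosBpihalf.
Qed.

Lemma Rintegral_support (f : R -> R) (C : R) : continuous f ->
  (forall x, `|f x| <= C) -> \int[mu]_x f x = \int[mu]_(x in I01) f x.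
Proof.
move=> cf fC; rewrite /Rintegral; congr fine.
rewrite (negligible_integral _ _ (integrable_continuous_bounded mu cf fC) (proj1 mur))//.
  by rewrite setTD setCK.
exact: measurableC.
Qed.

Lemma Rintegral_mu_sum (I : eqType) (s : seq I) (f : I -> R -> R) (C : I -> R) :
  (forall i, continuous (f i)) -> (forall i x, `|f i x| <= C i) ->
  \int[mu]_x (\sum_(i <- s) f i x) = \sum_(i <- s) \int[mu]_x f i x.
Proof.
move=> cf fC; elim: s => [|i s IH].
  by rewrite big_nil; under eq_Rintegral do rewrite big_nil;
    rewrite Rintegral_cst// mul0r.
rewrite big_cons -IH; under eq_Rintegral do rewrite big_cons.
apply: RintegralD => //; first exact: integrable_continuous_bounded (fC i).
apply: (@integrable_continuous_bounded _ _ _ (\sum_(i <- s) C i)).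
  by apply: continuous_big => // ?; exact: add_continuous.
by move=> x; rewrite (le_trans (ler_norm_sum _ _ _))// ler_sum.
Qed.

(** The sum reassembles the integral of the density with coefficient [b] times cos(2 pi w x). On
    [0, 1] the angle is at most pi/4 < 1, so the cosine is at least [cos 1] there. *)
Lemma sum_Re_fourier_ge (b w : R) N : -1 <= b <= 1 -> 0 <= w <= 8^-1 ->
  cos 1 * (1 + a * b / 2) ^+ N <=
  \sum_(u <- riesz_terms l N) (b / 2) ^+ u.1 * complex.Re (fourier mu (u.2%:~R + w)).
Proof.
move=> hb /andP[w0 w8].
have crho := @continuous_riesz_density b N.
have brho x := @riesz_density_bound b N x hb.
have rho0 x : 0 <= density b N x := riesz_density_ge0 (fun=> hb) _ N x.
have Zc (c t x : R) : `|c * cos (t * x)| <= `|c|.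
  by rewrite normrM ler_piMr// cos_max.
have cZ (c t : R) : continuous (fun x => c * cos (t * x)).
  by move=> x; apply: cvgM; [exact: cvg_cst|exact: continuous_cosM].
have -> : \sum_(u <- riesz_terms l N) (b / 2) ^+ u.1 *
    complex.Re (fourier mu (u.2%:~R + w)) =
    \int[mu]_x (density b N x * cos (2 * pi * w * x)).
  under [RHS]eq_Rintegral do rewrite riesz_density_cos.
  transitivity (\int[mu]_x (\sum_(u <- riesz_terms l N)
      (b / 2) ^+ u.1 * cos (- (2 * pi * (u.2%:~R + w)) * x))).
    rewrite (Rintegral_mu_sum _ (C := fun u => `|(b / 2) ^+ u.1|))//.
    apply: eq_bigr => u _; rewrite Re_fourier RintegralZl//.
    apply: integrable_continuous_bounded; first exact: continuous_cosM.
    by move=> x; exact: cos_max.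
  apply: eq_Rintegral => x _; apply: eq_bigr => u _; congr (_ * _).
  by rewrite mulNr cosN; congr cos; ring.
rewrite -(integral_riesz_density N hb).
have cp : continuous (fun x => density b N x * cos (2 * pi * w * x)).
  by move=> x; apply: cvgM; [exact: crho|exact: continuous_cosM].
have bp x : `|density b N x * cos (2 * pi * w * x)| <= 2 ^+ N.
  by rewrite normrM (le_trans _ (brho x))// ler_piMr// cos_max.
rewrite -RintegralZl//; last exact: integrable_continuous_bounded.
rewrite (Rintegral_support cp bp).
have cq : continuous (fun x => cos 1 * density b N x).
  by move=> x; apply: cvgM; [exact: cvg_cst|exact: crho].
have bq x : `|cos 1 * density b N x| <= 2 ^+ N.
  by rewrite normrM (le_trans _ (brho x))// ler_piMl// cos_max.
rewrite (Rintegral_support cq bq); apply: le_Rintegral => //.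
- by apply: integrableS (integrable_continuous_bounded mu cq bq).
- by apply: integrableS (integrable_continuous_bounded mu cp bp).
move=> x; rewrite /= in_itv/= => /andP[x0 x1]; rewrite mulrC ler_wpM2l//.
have pi2 := @pihalf_lt2 R; have pi1 := @pi_ge2 R.
have y0 : 0 <= 2 * pi * w * x by rewrite !mulr_ge0// pi_ge0.
have y1 : 2 * pi * w * x <= 1.
  have : w * x <= 8^-1 by rewrite -[leRHS]mulr1 ler_pM.
  rewrite -mulrA; nra.
by rewrite leNgt ltr_cos ?in_itv/= -?leNgt// ?ler01 ?y0/=; lra.
Qed.

End riesz_product_fourier.

(** * Inequalities for powers *)

Section power_inequalities.
Context {R : realType}.
Implicit Types x y p : R.

Lemma powR_exprn x k p : 0 <= x -> (x ^+ k) `^ p = (x `^ p) ^+ k.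
Proof.
move=> x0; rewrite -(powR_mulrn k x0) -(powR_mulrn k (powR_ge0 x p)).
by rewrite -!powRrM (mulrC p).
Qed.

(** A form of Young's inequality with a free parameter: for [y <= k * x] the first term on the right
    dominates, otherwise the second does. *)
Lemma powRB1_mul_le p k x y : 1 <= p -> 0 < k -> 0 < x -> 0 <= y ->
  x `^ (p - 1) * y <= k * x `^ p + k `^ (1 - p) * y `^ p.
Proof.
move=> p1 k0 x0 y0; have p0 : 0 < p by lra.
have [yx|xy] := leP y (k * x).
  apply: (@le_trans _ _ (k * x `^ p)); last by rewrite lerDl mulr_ge0 ?powR_ge0.
  rewrite -(mulr_powRB1 (ltW x0) p0) mulrA [leRHS]mulrC.
  by rewrite ler_wpM2l ?powR_ge0.
apply: (@le_trans _ _ (k `^ (1 - p) * y `^ p)); last first.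
  by rewrite lerDr mulr_ge0 ?powR_ge0// ltW.
rewrite -(mulr_powRB1 y0 p0) mulrCA [leLHS]mulrC ler_wpM2l//.
rewrite -(opprB p 1) powRN mulrC ler_pdivlMr ?powR_gt0//.
rewrite -powRM ?(ltW x0) ?(ltW k0)//.
by rewrite ge0_ler_powR ?nnegrE ?mulr_ge0 ?(ltW x0) ?(ltW k0)//; [lra|rewrite mulrC ltW].
Qed.

Lemma expr_unbounded (r A : R) : 1 < r -> exists N, A <= r ^+ N.
Proof.
move=> r1; pose h := r - 1; have h0 : 0 < h by rewrite subr_gt0.
have B N : 1 + N%:R * h <= r ^+ N.
  elim: N => [|N IH]; first by rewrite mul0r addr0 expr0.
  rewrite exprS; apply: (@le_trans _ _ (r * (1 + N%:R * h))); last first.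
    by rewrite ler_wpM2l//; lra.
  rewrite -natr1 (_ : r = 1 + h); last by rewrite /h; ring.
  have : 0 <= N%:R * h * h by rewrite !mulr_ge0// ltW.
  by rewrite /h; nra.
exists (Num.bound (A / h)); apply: le_trans (B _).
have [A0|A0] := leP 0 A; last first.
  by apply: (@le_trans _ _ 0); [exact: ltW|rewrite addr_ge0// mulr_ge0// ltW].
have := archi_boundP (divr_ge0 A0 (ltW h0)); rewrite ltr_pdivrMr// => /ltW AB.
by rewrite (le_trans AB)// lerDr.
Qed.

End power_inequalities.

(** * Divergence of the energy *)

Section infinite_energy.
Context {R : realType}.
Local Notation leb := (@lebesgue_measure R).
Variables (l : nat) (a : R) (mu : {finite_measure set (measurableTypeR R) -> \bar R}).
Hypotheses (l3 : (3 <= l)%N) (ha : -1 <= a <= 1) (a0 : a != 0).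
Hypothesis mur : is_riesz_product (fun=> a) (fun=> ha) (fun j => (l ^ j)%N) mu.
Local Notation b0 := (`|a| / 2).
Local Notation F z := (Normc.normc (fourier mu z)).

Let b00 : 0 < b0. Proof. by rewrite divr_gt0// normr_gt0. Qed.

(** At each positive power of [l] the transform has modulus at least |a|/2, while the weight |z|^s
    is unbounded along these points. *)
Lemma fourier_energy0_pinfty (s : R) : 0 < s ->
  fourier_energy s 0 mu = +oo%E.
Proof.
move=> s0; rewrite /fourier_energy eqxx; apply/eqyP => A A0.
have l1 : 1 < l%:R :> R by rewrite ltr1n (leq_trans _ l3).
have ls : 1 < l%:R `^ s.
  by rewrite -ltr_ln ?posrE ?powR_gt0// ?ln1 ?ln_powR ?mulr_gt0 ?ln_gt0//; lra.
have [N HN] := expr_unbounded (A / (b0 ^+ 2)) ls.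
apply: le_trans (ereal_sup_ubound _); last by exists (l ^ N.+1)%:R.
rewrite lee_fin; apply: (@le_trans _ _ (b0 ^+ 2 * (l%:R `^ s) ^+ N.+1)).
  rewrite -ler_pdivrMl ?exprn_gt0// mulrC (le_trans HN)//.
  by rewrite ler_eXn2l.
rewrite natrX normrX ger0_norm// powR_exprn// ler_wpM2r ?exprn_ge0 ?powR_ge0//.
have b0F : b0 <= F (l%:R ^+ N.+1).
  rewrite (le_trans _ (normc_ge_normRe _))// -natrX (Re_fourier_power l3 mur)//.
  by rewrite normrM normfV (ger0_norm (ler0n _ 2)).
by rewrite lerXn2r ?nnegrE ?(ltW b00)// (le_trans (ltW b00)).
Qed.

Variable p : R.
Hypothesis p2 : 2 <= p.
Local Notation D := (1 + 2 * b0 `^ p).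

Let p0 : 0 < p. Proof. exact: lt_le_trans p2. Qed.

Let p1 : 1 <= p. Proof. by apply: le_trans p2; rewrite ler1n. Qed.

Let b012 : b0 <= 2^-1.
Proof. by rewrite ler_piMl ?invr_ge0// ler_norml. Qed.

Lemma sum_powR_riesz_terms N :
  \sum_(u <- riesz_terms l N) (b0 ^+ u.1) `^ p = D ^+ N.
Proof.
by rewrite -(sum_riesz_terms _ l); apply: eq_bigr => u _; rewrite powR_exprn// ltW.
Qed.

(* Test the Riesz product [mu] against the Riesz product with coefficient [b]
   such that [b / 2] is the dual power [|a / 2| ^ (p - 1)], up to the sign: its
   integral against [mu] is exactly [D ^+ N]. *)
Lemma sum_powR_fourier_ge N (w : R) : 0 <= w <= 8^-1 ->
  (cos 1 / 2) `^ p * D ^+ N <=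
  \sum_(u <- riesz_terms l N) F (u.2%:~R + w) `^ p.
Proof.
(* Half of [cos 1]: the first term of Young's inequality then absorbs exactly half of the lower
   bound. *)
move=> w8; set k := cos 1 / 2; have k0 : 0 < k by rewrite divr_gt0// cos1_gt0.
pose b := 2 * (Num.sg a * b0 `^ (p - 1)).
have nb : `|b / 2| = b0 `^ (p - 1).
  by rewrite /b mulrAC divff// mul1r normrM normr_sg a0 mul1r ger0_norm ?powR_ge0.
(* As [p - 1 >= 1] and [b0 <= 1/2], the dual power is at most 1/2, so [b] is an admissible
   coefficient. *)
have hb : -1 <= b <= 1.
  rewrite -ler_norml -[b](@mulfVK _ 2)// normrM nb (ger0_norm (ler0n _ 2)).
  rewrite -ler_pdivlMr// mul1r (le_trans _ b012)//.
  have p11 : 1 <= p - 1 by rewrite lerBrDr.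
  apply: ge1r_powR p11; rewrite b00/= (le_trans b012)//; lra.
have ab : 1 + a * b / 2 = D.
  congr (_ + _); rewrite /b -(mulr_powRB1 (ltW b00) p0).
  by rewrite normrEsg; field.
have := sum_Re_fourier_ge l3 mur N hb w8; rewrite ab => G.
set S := \sum_(u <- _) _.
have : cos 1 * D ^+ N <= k * D ^+ N + k `^ (1 - p) * S.
  apply: le_trans G _; rewrite -sum_powR_riesz_terms !mulr_sumr -big_split.
  apply: ler_sum => u _; apply: le_trans (ler_norm _) _.
  rewrite normrM normrX nb -powR_exprn ?(ltW b00)//.
  apply: (@le_trans _ _ ((b0 ^+ u.1) `^ (p - 1) * F (u.2%:~R + w))).
    by rewrite ler_wpM2l ?powR_ge0// normc_ge_normRe.
  apply: powRB1_mul_le => //; first exact: exprn_gt0.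
  exact: le_trans (normr_ge0 _) (normc_ge_normRe _).
have -> : cos 1 = k + k by rewrite /k; field.
rewrite mulrDl lerD2l => H.
rewrite -(mulr_powRB1 (ltW k0) p0).
rewrite -mulrA mulrCA -ler_pdivlMl ?powR_gt0// -powRN opprB//.
Qed.

Lemma measurable_energy_integrand (t : R) :
  measurable_fun [set: R] (fun z => (F z `^ p * `|z| `^ t)%:E).
Proof.
apply/measurable_EFinP; apply: measurable_funM.
  apply: (measurableT_comp (measurable_powR p)).
  exact: measurable_normc_fourier.
by apply: (measurableT_comp (measurable_powR t)); exact: normr_measurable.
Qed.

(** Separates the frequency 0, near which the weight [t] is not controlled. *)
Lemma sum_uniq_le0 (G : int -> R) (S : seq int) : uniq S -> (forall n, 0 <= G n) ->
  \sum_(n <- S) G n <= G 0 + \sum_(n <- S | n != 0) G n.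
Proof.
move=> uS G0; have [S0|S0] := boolP (0 \in S).
  by rewrite (bigD1_seq 0).
rewrite [leLHS](_ : _ = \sum_(n <- S | n != 0) G n) ?lerDr//.
rewrite [RHS]big_mkcond [LHS]big_seq [RHS]big_seq; apply: eq_bigr => n nS.
by case: eqP => // n0; rewrite n0 (negbTE S0) in nS.
Qed.

(* [|n + w| >= 1] holds for the nonzero frequencies [n], hence replacing [t] by
   [Num.min t 0] only decreases the weight. *)
Lemma sum_weighted_fourier_ge (N : nat) (t w : R) : 0 <= w <= 8^-1 ->
  (l%:R `^ Num.min t 0) ^+ N.+1
    * ((cos 1 / 2) `^ p * D ^+ N - (2 * fine (mu setT)) `^ p) <=
  \sum_(n <- map snd (riesz_terms l N))
    F (n%:~R + w) `^ p * `|n%:~R + w| `^ t.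
Proof.
move=> w8; have := w8 => /andP[w0 w1].
set S := map _ _; set t' := Num.min t 0.
have l1 : 1 <= l%:R :> R by rewrite ler1n (leq_trans _ l3).
have lt0 : 0 < (l%:R `^ t') ^+ N.+1 by rewrite exprn_gt0// powR_gt0//; lra.
apply: (@le_trans _ _ ((l%:R `^ t') ^+ N.+1 *
    \sum_(n <- S | n != 0) F (n%:~R + w) `^ p)).
  (* The term of frequency 0 is at most the subtracted power of twice the mass. *)
  rewrite ler_pM2l// lerBlDl.
  apply: (le_trans (sum_powR_fourier_ge N w8)).
  have := @sum_uniq_le0 (fun n => F (n%:~R + w) `^ p) S (riesz_terms_uniq N l3).
  rewrite /S big_map => /(_ (fun n => powR_ge0 _ _)) H; apply: (le_trans H).
  rewrite lerD2r ge0_ler_powR ?nnegrE ?(ltW p0)//.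
  - exact: le_trans (normr_ge0 _) (normc_ge_normRe _).
  - by rewrite mulr_ge0// fine_ge0.
  - exact: normc_fourier_le_mass.
rewrite mulr_sumr [leRHS](bigID (fun n => n != 0))/= -[leLHS]addr0 lerD//; last first.
  by apply: sumr_ge0 => n _; rewrite mulr_ge0 ?powR_ge0.
rewrite big_seq_cond [leRHS]big_seq_cond.
apply: ler_sum => n /andP[/mapP[u uT ->] u0].
rewrite mulrC ler_wpM2l ?powR_ge0//.
have := riesz_terms_lt l3 uT; have := riesz_terms_neq0 l3 uT u0.
move: (u.2 : int) => m m2 ml.
have m2R : 2 <= `|m%:~R| :> R by rewrite -intr_norm -(pmulrn _ `|m|%N); rewrite ler_nat.
have mlR : `|m%:~R| + 1 <= l%:R ^+ N.+1 :> R.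
  have mlN : (`|m| < l ^ N.+1)%N by apply: leq_ltn_trans ml; rewrite leq_pmull.
  by rewrite -intr_norm -(pmulrn _ `|m|%N) -natrX natr1 ler_nat.
have w18 : w <= 1 by lra.
have nw : `|w| <= 1 by rewrite ger0_norm.
have h1 : 1 <= `|m%:~R + w|.
  have := lerB_normD m%:~R w; lra.
have h2 : `|m%:~R + w| <= l%:R ^+ N.+1.
  by rewrite (le_trans (ler_normD _ _))//; lra.
apply: (@le_trans _ _ (`|m%:~R + w| `^ t')).
  rewrite -powR_exprn; last by lra.
  rewrite -[t']opprK !(powRN _ (- t')) lef_pV2 ?posrE ?powR_gt0 ?exprn_gt0//; try lra.
  by rewrite ge0_ler_powR ?nnegrE ?exprn_ge0// ?oppr_ge0 ?ge_min ?lexx ?orbT//; lra.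
by apply: ler_powR => //; rewrite ge_min lexx.
Qed.

(** The contribution of level [N] grows at least like the [N]-th power of l^t' D, up to a bounded
    term, and this ratio exceeds 1 exactly when t' > - ln D / ln l. *)
Lemma energy_integral_pinfty (t : R) : - (ln D / ln l%:R) < t ->
  (\int[leb]_z (F z `^ p * `|z| `^ t)%:E = +oo)%E.
Proof.
move=> dt; set J := integral _ _ _; set t' := Num.min t 0.
pose K := (2 * fine (mu setT)) `^ p; pose c := (cos 1 / 2 : R) `^ p.
have l1 : 1 < l%:R :> R by rewrite ltr1n (leq_trans _ l3).
have D1 : 1 < D by rewrite ltrDl mulr_gt0// powR_gt0.
have f0 (x : R) : 0 <= F x `^ p * `|x| `^ t by rewrite mulr_ge0 ?powR_ge0.
have J0 : (0 <= J)%E by apply: integral_ge0 => x _; rewrite lee_fin.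
have mf (n : int) : measurable_fun [set: R]
    (fun w : R => (F (n%:~R + w) `^ p * `|n%:~R + w| `^ t)%:E).
  apply: (measurableT_comp (measurable_energy_integrand t)).
  exact: measurable_funD.
pose V N := (l%:R `^ t') ^+ N.+1 * (c * D ^+ N - K).
(* The pointwise bound is integrated over w in [0, 1/8], which produces the factor 1/8. *)
have VJ N : ((8^-1 * V N)%:E <= J)%E.
  have [V0|V0] := ltP (V N) 0.
    by apply: le_trans J0; rewrite lee_fin pmulr_rle0 ?invr_gt0// ltW.
  pose S := map snd (riesz_terms l N).
  have := @sum_integral_shift_le R S _ (riesz_terms_uniq N l3)
    (measurable_energy_integrand t) (fun x => f0 x).
  apply: le_trans; rewrite -ge0_integral_sum//;
    [|by move=> n; exact: (measurable_funTS (mf n))|by move=> n x _; rewrite lee_fin].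
  apply: (@le_trans _ _ (\int[leb]_(w in `[0%R, 8^-1%R]) (V N)%:E)%E).
    rewrite integral_cst//= lebesgue_measure_itv/= lte_fin invr_gt0 ltr0n sube0.
    by rewrite -EFinM mulrC.
  pose g w := (\sum_(n <- S) (F (n%:~R + w) `^ p * `|n%:~R + w| `^ t)%:E)%E.
  have mg : measurable_fun setT g by exact: emeasurable_sum.
  have g0 w : (0 <= g w)%E by apply: sume_ge0 => n _; rewrite lee_fin.
  apply: (@le_trans _ _ (\int[leb]_(w in `[0%R, 8^-1%R]) g w)%E).
    apply: ge0_le_integral => //; first exact: measurable_funTS.
    move=> w; rewrite /= in_itv/= => w8; rewrite /g sumEFin lee_fin.
    exact: sum_weighted_fourier_ge.
  apply: ge0_subset_integral => //; first exact: measurable_funTS.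
  by move=> w; rewrite /= !in_itv/= => /andP[-> w8]/=; apply: le_lt_trans w8 _; lra.
(* Capping [t] at 0 is harmless because the threshold is negative. *)
have lD : 1 < l%:R `^ t' * D.
  rewrite -ltr_ln ?posrE ?mulr_gt0 ?powR_gt0//; try lra.
  rewrite ln1 lnM ?posrE ?powR_gt0//; try lra.
  rewrite ln_powR -ltrBlDr sub0r -ltr_pdivrMr ?ln_gt0// mulNr.
  by rewrite lt_min dt oppr_lt0 divr_gt0// ln_gt0.
have lt1 : 0 < l%:R `^ t' <= 1.
  rewrite powR_gt0/=; last by lra.
  by rewrite -[leRHS](powRr0 (l%:R : R)); apply: ler_powR;
    [exact: ltW|rewrite ge_min lexx orbT].
have c0 : 0 < c by rewrite powR_gt0// divr_gt0// cos1_gt0.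
have K0 : 0 <= K by exact: powR_ge0.
have V_ge N : l%:R `^ t' * c * (l%:R `^ t' * D) ^+ N - K <= V N.
  rewrite /V mulrBr exprMn exprS lerB//; last first.
    by rewrite ler_piMl// -exprS exprn_ile1//; case/andP: lt1 => /ltW.
  by rewrite le_eqVlt; apply/orP; left; apply/eqP; ring.
apply/eqyP => A A0.
have [N HN] := expr_unbounded ((8 * A + K) / (l%:R `^ t' * c)) lD.
apply: le_trans (VJ N); rewrite lee_fin -ler_pdivrMl ?invr_gt0// invrK.
apply: le_trans (V_ge N); rewrite lerBrDr.
have lc : 0 < l%:R `^ t' * c by rewrite mulr_gt0//; case/andP: lt1.
by move: HN; rewrite ler_pdivrMr// [leRHS]mulrC.
Qed.

End infinite_energy.

(** * Integrability of powers at infinity and at the origin *)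

Section power_integrals.
Context {R : realType}.
Local Notation leb := (@lebesgue_measure R).
Implicit Types q b y z : R.

Lemma sum_geometric_le q K : 0 <= q < 1 ->
  \sum_(0 <= k < K) q ^+ k <= (1 - q)^-1.
Proof.
move=> /andP[q0 q1]; have q2 : 0 < 1 - q by rewrite subr_gt0.
rewrite -[leRHS]mul1r ler_pdivlMr// (_ : _ * _ = 1 - q ^+ K).
  by rewrite lerBlDr lerDl exprn_ge0.
elim: K => [|K IH]; first by rewrite big_geq// mul0r expr0 subrr.
by rewrite big_nat_recr//= mulrDl IH exprSr; ring.
Qed.

Lemma dyadic_bracket y : 1 <= y -> exists k, 2 ^+ k <= y < 2 ^+ k.+1.
Proof.
move=> y1; have [N HN] := @expr_unbounded R 2 (y + 1) (ltr1n _ 2).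
have ex : exists k, y < 2 ^+ k by exists N; rewrite (lt_le_trans _ HN)// ltrDl.
case: (ex_minnP ex) => -[|k] yk mk; first by move: yk; rewrite expr0 ltNge y1.
by exists k; rewrite yk andbT leNgt; apply/negP => /mk; rewrite ltnn.
Qed.

Lemma ge0_powR_le (c x y : R) : 0 <= c -> 0 <= x -> x <= y -> x `^ c <= y `^ c.
Proof. by move=> c0 x0 xy; rewrite ge0_ler_powR// nnegrE// (le_trans x0). Qed.

Lemma powRN_le (c x y : R) : 0 <= c -> 0 < x -> x <= y -> y `^ (- c) <= x `^ (- c).
Proof.
move=> c0 x0 xy; rewrite !powRN lef_pV2 ?posrE ?powR_gt0//.
  by rewrite ge0_powR_le// ltW.
exact: lt_le_trans xy.
Qed.

Lemma measurable_powR_shift (b z : R) :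
  measurable_fun [set: R] (fun x => (1 + `|x - z|) `^ b).
Proof.
apply: (measurableT_comp (measurable_powR b)).
apply: measurable_funD => //; apply: (measurableT_comp (@normr_measurable _ setT)).
exact: measurable_funB.
Qed.

(** Dyadic layers in 1 + |x|: heights 2^(-bk) and radii 2^(k+1) give a geometric series of ratio
    [q], that is 2^(1-b). *)
Lemma integral_powR_decay_lty b : 1 < b ->
  (\int[leb]_x ((1 + `|x|) `^ (- b))%:E < +oo)%E.
Proof.
move=> b1; pose q : R := 2 * 2 `^ (- b).
have q01 : 0 <= q < 1.
  rewrite mulr_ge0 ?powR_ge0//= /q -[X in X * _](@powRr1 R 2)//.
  rewrite -powRD ?pnatr_eq0 ?implybT//.
  rewrite -ltr_ln ?posrE ?powR_gt0// ln1 ln_powR nmulr_rlt0 ?ln_gt0 ?ltr1n//; lra.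
apply: (@integral_layers_lty _ _ (fun k => (2 `^ (- b)) ^+ k) (fun k => 2 ^+ k.+1)
  (2 * (1 - q)^-1)).
- have := measurable_powR_shift (- b) 0; apply: eq_measurable_fun => x _.
  by rewrite subr0.
- by move=> x; exact: powR_ge0.
- by move=> k; rewrite exprn_ge0// powR_ge0.
- by move=> k; rewrite exprn_ge0.
- move=> x _; have [|k /andP[k1 k2]] := @dyadic_bracket (1 + `|x|).
    by rewrite lerDl.
  exists k; last by apply: lt_trans k2; rewrite ltrDr.
  by rewrite -powR_exprn// powRN_le ?exprn_gt0//; lra.
- move=> K; apply: (le_trans _ (ler_wpM2l _ (sum_geometric_le K q01)));
    rewrite ?mulr_ge0 ?powR_ge0// mulr_sumr le_eqVlt; apply/orP; left; apply/eqP.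
  by apply: eq_bigr => k _; rewrite /q exprMn exprS; ring.
Qed.

(** Dyadic layers in 1/|x|: heights 2^(b(k+1)) on |x| of size about 2^(-k), hence a geometric series
    of ratio 2^(b-1). *)
Lemma integral_powR_near0_lty b : 0 < b < 1 ->
  (\int[leb]_x (\1_(`]-1, 1[%classic : set R) x * `|x| `^ (- b))%:E < +oo)%E.
Proof.
move=> /andP[b0 b1]; pose q : R := 2^-1 * 2 `^ b.
have q01 : 0 <= q < 1.
  rewrite mulr_ge0 ?powR_ge0//= /q -(@powR_inv1 R 2)// -powRD ?pnatr_eq0 ?implybT//.
  rewrite -ltr_ln ?posrE ?powR_gt0// ln1 ln_powR nmulr_rlt0 ?ln_gt0 ?ltr1n//; lra.
apply: (@integral_layers_lty _ _ (fun k => (2 `^ b) ^+ k.+1) (fun k => 2 * 2^-1 ^+ k)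
  (2 * 2 `^ b * (1 - q)^-1)).
- apply: measurable_funM; first exact: measurable_indic.
  by apply: (measurableT_comp (measurable_powR (- b))); exact: normr_measurable.
- by move=> x; rewrite mulr_ge0 ?powR_ge0.
- by move=> k; rewrite exprn_ge0// powR_ge0.
- by move=> k; rewrite mulr_ge0// exprn_ge0// invr_ge0.
- move=> x; rewrite indicE; case: (boolP (x \in _)); last by rewrite mul0r eqxx.
  rewrite inE/= in_itv/= -ltr_norml mul1r => x1 xb.
  (* The power of 0 with a nonzero exponent is 0 by convention, so the origin lies outside the set
     where the function is nonzero. *)
  have x0 : 0 < `|x|.
    rewrite lt_neqAle normr_ge0 andbT eq_sym; apply: contra_neq xb => ->.
    by rewrite powR0// oppr_eq0 gt_eqF.
  have [|k /andP[k1 k2]] := @dyadic_bracket `|x|^-1; first by rewrite invf_ge1// ltW.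
  exists k.
    rewrite -mulN1r powRrM powR_inv1// -powR_exprn//.
    by rewrite ge0_powR_le ?invr_ge0// ltW.
  rewrite exprVn ltr_pdivlMr ?exprn_gt0//; move: k1.
  rewrite -div1r ler_pdivlMr// mulrC => k1; apply: le_lt_trans k1 _; lra.
- move=> K; apply: (le_trans _ (ler_wpM2l _ (sum_geometric_le K q01)));
    rewrite ?mulr_ge0 ?powR_ge0// mulr_sumr le_eqVlt; apply/orP; left; apply/eqP.
  by apply: eq_bigr => k _; rewrite /q exprMn exprS; ring.
Qed.

End power_integrals.

(** * Weighted sums and splitting of kernels *)

Section weighted_sums.
Context {R : realType}.
Local Notation leb := (@lebesgue_measure R).

Lemma le_integral_unit_itv (v : R) (h : R -> \bar R) : 0 <= v ->
  measurable_fun [set: R] h -> (forall w : R, 0 <= w < 1 -> (v%:E <= h w)%E) ->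
  (v%:E <= \int[leb]_(w in `[0%R, 1%R[) h w)%E.
Proof.
move=> v0 mh vh; apply: (@le_trans _ _ (\int[leb]_(w in `[0%R, 1%R[) v%:E)%E).
  by rewrite integral_cst//= lebesgue_measure_itv/= lte01 sube0 mule1.
by apply: ge0_le_integral => //; exact: measurable_funTS.
Qed.

Lemma powR_decay_shift_le (b y w : R) : 0 <= b -> 0 <= w < 1 ->
  (1 + `|y|) `^ (- b) <= 2 `^ b * (1 + `|y + w|) `^ (- b).
Proof.
move=> b0 /andP[w0 w1].
have h0 : 0 < 1 + `|y + w| by rewrite ltr_wpDr.
have h1 : 0 < 1 + `|y| by rewrite ltr_wpDr.
rewrite !powRN ler_pdivlMr ?powR_gt0// mulrC ler_pdivrMr ?powR_gt0//.
rewrite -powRM ?(ltW h1)// ge0_powR_le// ?(ltW h0)//.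
have := ler_normD y w; have := normr_ge0 y; rewrite (ger0_norm w0); lra.
Qed.

(* The unit translates [n + [0, 1[] are disjoint, so the sum is controlled by
   the integral of [(1 + |x|) ^ (- b)]. *)
Lemma sum_powR_decay_le (b : R) : 1 < b ->
  exists2 W : R, 0 < W & forall (S : seq int) (z : R), uniq S ->
    \sum_(n <- S) (1 + `|n%:~R - z|) `^ (- b) <= W.
Proof.
move=> b1; have := integral_powR_decay_lty b1; set I := integral _ _ _ => Ioo.
have I0 : (0 <= I)%E by apply: integral_ge0 => x _; rewrite lee_fin powR_ge0.
exists (2 `^ b * fine I + 1) => [|S z uS].
  by rewrite ltr_wpDl// mulr_ge0 ?powR_ge0// fine_ge0.
apply: (@le_trans _ _ (2 `^ b * fine I)); last by rewrite lerDl.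
have mf : measurable_fun [set: R] (fun x : R => ((1 + `|x|) `^ (- b))%:E).
  apply/measurable_EFinP; have := measurable_powR_shift (- b) (0 : R).
  by apply: eq_measurable_fun => x _; rewrite subr0.
pose g (x : R) := ((2 `^ b)%:E * ((1 + `|x - z|) `^ (- b))%:E)%E.
have mg0 : measurable_fun [set: R] (fun x => ((1 + `|x - z|) `^ (- b))%:E).
  by apply/measurable_EFinP; exact: measurable_powR_shift.
have mg : measurable_fun [set: R] g by exact: measurable_funeM.
have g0 x : (0 <= g x)%E by rewrite mule_ge0 ?lee_fin ?powR_ge0.
have gI : (\int[leb]_x g x = (2 `^ b)%:E * I)%E.
  have h0 x : (0 <= ((1 + `|x - z|) `^ (- b))%:E)%E by rewrite lee_fin powR_ge0.
  rewrite (ge0_integralZl leb measurableT mg0 (fun x _ => h0 x)); last first.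
    by rewrite lee_fin powR_ge0.
  by rewrite /I -(ge0_integral_shift (- z) measurableT mf).
rewrite -lee_fin EFinM fineK; last by rewrite ge0_fin_numE.
rewrite -gI -sumEFin.
apply: le_trans (sum_integral_shift_le uS mg g0); apply: lee_sum => n _.
apply: le_integral_unit_itv => [||w w01]; first exact: powR_ge0.
  by apply: (measurableT_comp mg); exact: measurable_funD.
rewrite /g -EFinM lee_fin addrAC; apply: powR_decay_shift_le => //; lra.
Qed.

(** Jensen's inequality for weights of total at most [W], up to the factor 2^p, obtained by summing
    Young's inequality with one common parameter. *)
Lemma powR_weighted_sum_le (I : Type) (s : seq I) (w x : I -> R) (p W : R) :
  1 <= p -> 0 < W -> (forall i, 0 <= w i) -> (forall i, 0 <= x i) ->
  \sum_(i <- s) w i <= W ->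
  (\sum_(i <- s) w i * x i) `^ p <=
  2 `^ p * W `^ (p - 1) * \sum_(i <- s) w i * x i `^ p.
Proof.
move=> p1 W0 w0 x0 sW; set X := \sum_(i <- s) w i * x i.
set Y := \sum_(i <- s) _.
have X0 : 0 <= X by apply: sumr_ge0 => i _; rewrite mulr_ge0.
have Y0 : 0 <= Y by apply: sumr_ge0 => i _; rewrite mulr_ge0 ?powR_ge0.
move: X0; rewrite le_eqVlt => /predU1P[<-|X0].
  by rewrite powR0 ?gt_eqF ?mulr_ge0 ?powR_ge0//; lra.
(* Chosen so that [k * W] is half of [X] and can be absorbed on the left. *)
pose k := X / (2 * W); have k0 : 0 < k by rewrite divr_gt0// mulr_gt0.
have : X <= k * W + k `^ (1 - p) * Y.
  apply: (@le_trans _ _ (k * \sum_(i <- s) w i + k `^ (1 - p) * Y)); last first.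
    by rewrite lerD2r ler_wpM2l// ltW.
  rewrite !mulr_sumr -big_split; apply: ler_sum => i _ /=.
  rewrite [X in X + _]mulrC [X in _ + X]mulrCA -mulrDr ler_wpM2l//.
  by have := powRB1_mul_le p1 k0 (ltr01 : 0 < 1 :> R) (x0 i); rewrite !powR1 mul1r mulr1.
have -> : k * W = X / 2 by rewrite /k; field; rewrite gt_eqF.
rewrite -lerBlDl (_ : X - X / 2 = X / 2); last by field.
rewrite -(opprB p 1) powRN ler_pdivlMl ?powR_gt0// => H.
have XE : X = 2 * (X / 2) by field.
have kE : k = (X / 2) / W by rewrite /k; field; rewrite gt_eqF.
have x20 : 0 < X / 2 by rewrite divr_gt0.
rewrite {1}XE powRM ?(ltW x20)// -mulrA ler_wpM2l ?powR_ge0//.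
have kp : k `^ (p - 1) = (X / 2) `^ (p - 1) / W `^ (p - 1).
  rewrite kE (powRM _ (ltW x20)) ?invr_ge0 ?(ltW W0)//.
  by rewrite -(powR_inv1 (ltW W0)) -powRrM mulN1r powRN.
have pp : 0 < p by lra.
move: H; rewrite kp mulrAC ler_pdivrMr ?powR_gt0//.
by rewrite -(mulr_powRB1 (ltW x20) pp) mulrC [leRHS]mulrC.
Qed.

(** The larger of [A] and [B] is at least (1 + m)/2. A power [de] of it yields the decay in [m]; its
    remaining exponent is transferred to the smaller one, which then carries [1 + ep] in total. *)
Lemma powR_kernel_le (A B m b g de ep : R) :
  1 <= A -> 1 <= B -> 0 <= m -> 1 + m <= A + B ->
  0 <= de -> de <= b -> de <= g -> b + g = de + 1 + ep ->
  A `^ (- b) * B `^ (- g) <= 2 `^ de * (1 + m) `^ (- de)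
     * (A `^ (- (1 + ep)) + B `^ (- (1 + ep))).
Proof.
have W (A' B' b' g' : R) : 1 <= A' -> 1 <= B' -> 0 <= m -> 1 + m <= A' + B' ->
  0 <= de -> de <= b' -> b' + g' = de + 1 + ep -> B' <= A' ->
  A' `^ (- b') * B' `^ (- g') <= 2 `^ de * (1 + m) `^ (- de) * B' `^ (- (1 + ep)).
  move=> A1 B1 m0 mAB d0 db bg BA.
  have Bn0 : B' != 0 by rewrite gt_eqF//; lra.
  have An0 : A' != 0 by rewrite gt_eqF//; lra.
  have -> : - b' = - de + - (b' - de) by ring.
  rewrite powRD ?An0 ?implybT// -mulrA ler_pM ?mulr_ge0 ?powR_ge0//.
    have -> : 2 `^ de * (1 + m) `^ (- de) = ((1 + m) / 2) `^ (- de).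
      rewrite powRM ?invr_ge0//; last lra.
      rewrite mulrC; congr (_ * _).
      by rewrite -powR_inv1// -powRrM; congr (_ `^ _); ring.
    by rewrite powRN_le//; lra.
  have -> : - (1 + ep) = - (b' - de) + - g' by have := bg; lra.
  rewrite powRD ?Bn0 ?implybT// ler_wpM2r ?powR_ge0// powRN_le//; lra.
move=> A1 B1 m0 mAB d0 db dg bg.
have K0 : 0 <= 2 `^ de * (1 + m) `^ (- de) by rewrite mulr_ge0 ?powR_ge0.
have [BA|/ltW AB] := leP B A.
  rewrite (le_trans (W _ _ _ _ A1 B1 m0 mAB d0 db bg BA))// ler_wpM2l//.
  by rewrite lerDr powR_ge0.
rewrite mulrC (le_trans (W _ _ _ _ B1 A1 m0 _ d0 dg _ AB))//; [lra|lra|].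
by rewrite ler_wpM2l// lerDl powR_ge0.
Qed.

End weighted_sums.

(** * Convergence of the energy *)

Section finite_energy.
Context {R : realType}.
Local Notation leb := (@lebesgue_measure R).

(** Frequencies added in passing from level [N] to [N.+1] have modulus at least [l ^ N.+1] / 2, so
    together they add at most [C * q ^+ N], with [q < 1]. *)
Lemma sum_weighted_riesz_terms_le (l : nat) (x de : R) : (3 <= l)%N ->
  0 <= x -> 0 <= de -> (1 + 2 * x) * l%:R `^ (- de) < 1 ->
  exists2 H : R, 0 <= H & forall N, \sum_(u <- riesz_terms l N)
    x ^+ u.1 * (1 + `|u.2%:~R|) `^ (- de) <= H.
Proof.
move=> l3 x0 d0; set q := _ * _ => q1.
have q0 : 0 <= q by rewrite mulr_ge0 ?powR_ge0//; lra.
pose C := 2 * x * 2 `^ de * l%:R `^ (- de).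
have C0 : 0 <= C by rewrite !mulr_ge0 ?powR_ge0.
exists (1 + C * (1 - q)^-1) => [|N].
  by rewrite addr_ge0// mulr_ge0// invr_ge0 subr_ge0 ltW.
apply: (@le_trans _ _ (1 + C * \sum_(0 <= k < N) q ^+ k)); last first.
  by rewrite lerD2l ler_wpM2l// sum_geometric_le// q0.
elim: N => [|N IH].
  by rewrite big_seq1/= expr0 mul1r normr0 addr0 powR1 big_geq// mulr0 addr0.
rewrite big_riesz_termsS big_split/= big_nat_recr//= mulrDr addrA lerD//.
rewrite /q exprMn -(sum_riesz_terms x l N) mulr_suml mulr_sumr.
rewrite big_seq [leRHS]big_seq; apply: ler_sum => u uT.
have l0 : 0 < l%:R :> R by rewrite ltr0n; lia.
have B (m : int) : (l ^ N.+1 <= 2 * absz m)%N ->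
    (1 + `|m%:~R|) `^ (- de) <= 2 `^ de * l%:R `^ (- de) * (l%:R `^ (- de)) ^+ N :> R.
  move=> mN; rewrite -mulrA -exprS -powR_exprn ?(ltW l0)//.
  have -> : 2 `^ de = 2^-1 `^ (- de) :> R.
    by rewrite -powR_inv1// -powRrM mulrNN mul1r.
  rewrite -powRM ?exprn_ge0 ?invr_ge0 ?(ltW l0)//.
  rewrite powRN_le ?mulr_gt0 ?exprn_gt0 ?invr_gt0//.
  rewrite -intr_norm -(pmulrn _ `|m|%N) ler_pdivrMl// -natrX.
  by rewrite -[1]/(1%:R) -natrD -natrM ler_nat; lia.
have ul := riesz_terms_lt l3 uT.
have B1 : (l ^ N.+1 <= 2 * absz (u.2 + (l ^ N.+1)%N%:Z)%R)%N.
  by move: (u.2 : int) ul => m ul; lia.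
have B2 : (l ^ N.+1 <= 2 * absz (u.2 - (l ^ N.+1)%N%:Z)%R)%N.
  by move: (u.2 : int) ul => m ul; lia.
rewrite exprS -mulrDr.
apply: (@le_trans _ _ (x * x ^+ u.1 *
    (2 `^ de * l%:R `^ (- de) * (l%:R `^ (- de)) ^+ N *+ 2))).
  by rewrite ler_wpM2l ?mulr_ge0 ?exprn_ge0// mulr2n lerD// B.
by rewrite le_eqVlt; apply/orP; left; apply/eqP; rewrite /C; ring.
Qed.

Variables (l : nat) (a : R) (mu : {finite_measure set (measurableTypeR R) -> \bar R}).
Hypotheses (l3 : (3 <= l)%N) (ha : -1 <= a <= 1) (a0 : a != 0).
Hypothesis mur : is_riesz_product (fun=> a) (fun=> ha) (fun j => (l ^ j)%N) mu.
Variable p : R.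
Hypothesis p2 : 2 <= p.
Local Notation b0 := (`|a| / 2).
Local Notation D := (1 + 2 * b0 `^ p).
Local Notation F z := (Normc.normc (fourier mu z)).

Let b00 : 0 < b0. Proof. by rewrite divr_gt0// normr_gt0. Qed.

(** The majorant of the weighted transform: the decay in the frequency is separated from two kernels
    in [z], each integrable over the line. *)
Let G (de ep : R) N z : R := \sum_(u <- riesz_terms l N)
  (b0 ^+ u.1) `^ p * (1 + `|u.2%:~R|) `^ (- de)
    * ((1 + `|z|) `^ (- (1 + ep)) + (1 + `|u.2%:~R - z|) `^ (- (1 + ep))).

(** Jensen's inequality bounds the [p]-th power by a sum of kernels of exponent [1 - ep] centred at
    the frequencies; combined with the weight of exponent [b], these split into the two kernels of
    [G]. *)
Let fourier_le_G b de ep : 0 < ep -> 0 <= de -> de <= b -> de <= 1 - ep ->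
  b + (1 - ep) = de + 1 + ep ->
  exists2 C : R, 0 < C & forall z L, 1 <= `|z| -> (forall N, G de ep N z <= L) ->
    F z `^ p * `|z| `^ (- b) <= C * L.
Proof.
move=> ep0 d0 db dg bg; have p2' := p2.
have p1 : 1 <= p by lra.
have pm : 0 < p - 1 by lra.
(* The weights with exponent [be > 1] are summable uniformly in [z], and - be + p (be - 1) = - (1 -
   ep) is the exponent left after Jensen. *)
pose be := 1 + ep / (p - 1).
have be1 : 1 < be by rewrite ltrDl divr_gt0.
have [W W0 HW] := sum_powR_decay_le be1.
exists (4 `^ p * (2 `^ p * W `^ (p - 1)) * (2 `^ de * 2 `^ b)).
  by rewrite !mulr_gt0 ?powR_gt0.
move=> z L z1 HL.
have A0 : 0 < 1 + `|z| by rewrite ltr_wpDr.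
pose T := 2 `^ de * L * (1 + `|z|) `^ b.
have L0 : 0 <= L.
  by apply: le_trans (HL 0%N); apply: sumr_ge0 => u _;
    rewrite !mulr_ge0 ?addr_ge0 ?powR_ge0.
have T0 : 0 <= T by rewrite !mulr_ge0 ?powR_ge0.
pose Y := 2 `^ p * W `^ (p - 1) * T.
have Y0 : 0 <= Y by rewrite !mulr_ge0 ?powR_ge0.
have B0 (n : int) : 0 < 1 + `|n%:~R - z| by rewrite ltr_wpDr.
have TN N : \sum_(u <- riesz_terms l N)
    (b0 ^+ u.1) `^ p * (1 + `|u.2%:~R - z|) `^ (- (1 - ep)) <= T.
  rewrite /T -ler_pdivrMr ?powR_gt0// -powRN mulr_suml.
  apply: (@le_trans _ _ (2 `^ de * G de ep N z)); last first.
    by rewrite ler_wpM2l ?powR_ge0.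
  rewrite /G mulr_sumr; apply: ler_sum => u _.
  rewrite -mulrA (mulrCA (2 `^ de)) -mulrA mulrCA.
  rewrite [leRHS]mulrCA [leRHS](_ : _ = (b0 ^+ u.1) `^ p *
    (2 `^ de * (1 + `|u.2%:~R|) `^ (- de)
    * ((1 + `|z|) `^ (- (1 + ep)) + (1 + `|u.2%:~R - z|) `^ (- (1 + ep))))); last by ring.
  rewrite ler_wpM2l ?powR_ge0// mulrC; apply: powR_kernel_le => //; rewrite ?lerDl//.
  have := ler_normB (u.2%:~R - z) (- z); rewrite opprK subrK normrN; lra.
have SN N : \sum_(u <- riesz_terms l N) b0 ^+ u.1 * (2 / (1 + `|u.2%:~R - z|))
    <= 2 * Y `^ p^-1.
  rewrite (_ : \sum_(u <- _) _ = 2 * \sum_(u <- riesz_terms l N)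
     (1 + `|u.2%:~R - z|) `^ (- be) *
       (b0 ^+ u.1 * (1 + `|u.2%:~R - z|) `^ (be - 1))); last first.
    rewrite mulr_sumr; apply: eq_bigr => u _.
    rewrite (mulrCA _ (b0 ^+ u.1)) -powRD; last by rewrite (gt_eqF (B0 _)) implybT.
    by rewrite addrA addNr add0r powR_inv1 ?(ltW (B0 _))//; ring.
  rewrite ler_wpM2l//; set X := \sum_(u <- _) _.
  have X0 : 0 <= X.
    by apply: sumr_ge0 => u _; rewrite !mulr_ge0 ?powR_ge0// exprn_ge0// ltW.
  have -> : X = (X `^ p) `^ p^-1.
    by rewrite -powRrM divff ?powRr1// gt_eqF//; lra.
  apply: ge0_powR_le; rewrite ?powR_ge0 ?invr_ge0//; first lra.
  apply: le_trans (powR_weighted_sum_le p1 W0 _ _ _) _.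
  - by move=> u; exact: powR_ge0.
  - by move=> u; rewrite mulr_ge0 ?powR_ge0// exprn_ge0// ltW.
  - by have := HW _ z (riesz_terms_uniq N l3); rewrite big_map.
  rewrite /Y ler_wpM2l ?mulr_ge0 ?powR_ge0//; apply: le_trans (TN N).
  apply: ler_sum => u _; rewrite powRM ?powR_ge0 ?exprn_ge0 ?(ltW b00)//.
  rewrite mulrCA ler_wpM2l ?powR_ge0// -powRrM -powRD;
    last by rewrite (gt_eqF (B0 _)) implybT.
  rewrite le_eqVlt; apply/orP; left; apply/eqP; congr (_ `^ _).
  by rewrite /be; field; rewrite gt_eqF.
have FY : F z `^ p <= 4 `^ p * Y.
  have := normc_fourier_le mur SN; rewrite mulrA -natrM => FY.
  have YE : Y = (Y `^ p^-1) `^ p.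
    by rewrite -powRrM mulVf ?powRr1// gt_eqF//; lra.
  rewrite [X in _ * X]YE -powRM ?powR_ge0// ge0_powR_le//; first lra.
  exact: le_trans (normr_ge0 _) (normc_ge_normRe _).
(* Since |z| is at least 1, 1 + |z| <= 2|z|. *)
have zA : `|z| `^ (- b) <= 2 `^ b * (1 + `|z|) `^ (- b).
  have -> : 2 `^ b = 2^-1 `^ (- b) :> R.
    by rewrite -powR_inv1// -powRrM mulrNN mul1r.
  rewrite -powRM ?invr_ge0 ?(ltW A0)// powRN_le//; lra.
apply: (@le_trans _ _ (4 `^ p * Y * (2 `^ b * (1 + `|z|) `^ (- b)))).
  by rewrite ler_pM ?powR_ge0.
rewrite /Y /T le_eqVlt; apply/orP; left; apply/eqP.
have : (1 + `|z|) `^ b * (1 + `|z|) `^ (- b) = 1.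
  by rewrite -powRD ?subrr ?powRr0// (gt_eqF A0) implybT.
set s := _ `^ b; set s' := _ `^ (- b) => ss.
transitivity (4 `^ p * (2 `^ p * W `^ (p - 1)) * (2 `^ de * 2 `^ b) * L
  * (s * s')); first ring.
by rewrite ss mulr1.
Qed.

Let measurable_G de ep N : measurable_fun [set: R] (G de ep N).
Proof.
rewrite /G; apply: measurable_sum => u.
apply: measurable_funM => //; apply: measurable_funD.
  have := measurable_powR_shift (- (1 + ep)) (0 : R).
  by apply: eq_measurable_fun => x _; rewrite subr0.
have := measurable_powR_shift (- (1 + ep)) (u.2%:~R : R).
by apply: eq_measurable_fun => x _; rewrite distrC.
Qed.

Let G_ge0 de ep N z : 0 <= G de ep N z.
Proof. by apply: sumr_ge0 => u _; rewrite !mulr_ge0 ?addr_ge0 ?powR_ge0. Qed.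

Let G_nondecreasing de ep z : nondecreasing_seq (fun N => (G de ep N z)%:E).
Proof.
apply/nondecreasing_seqP => N; rewrite lee_fin /G big_riesz_termsS.
apply: ler_sum => u _; rewrite lerDl addr_ge0// !mulr_ge0 ?addr_ge0 ?powR_ge0//.
Qed.

(** Integrated term by term, each kernel gives a constant independent of the frequency; the
    remaining weighted sum is bounded uniformly in [N]. *)
Let integral_G_le de ep : 0 < ep -> 0 <= de -> D * l%:R `^ (- de) < 1 ->
  exists K : R, forall N, (\int[leb]_z (G de ep N z)%:E <= K%:E)%E.
Proof.
move=> ep0 d0 Dl; have ep1 : 1 < 1 + ep by rewrite ltrDl.
have [H H0 HH] := sum_weighted_riesz_terms_le l3 (powR_ge0 b0 p) d0 Dl.
have := integral_powR_decay_lty ep1; set I := integral _ _ _ => Ioo.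
have I0 : (0 <= I)%E by apply: integral_ge0 => x _; rewrite lee_fin powR_ge0.
have mg (z : R) : measurable_fun [set: R] (fun x => ((1 + `|x - z|) `^ (- (1 + ep)))%:E).
  by apply/measurable_EFinP; exact: measurable_powR_shift.
have mf : measurable_fun [set: R] (fun x : R => ((1 + `|x|) `^ (- (1 + ep)))%:E).
  by apply: eq_measurable_fun (mg 0) => x _; rewrite subr0.
have gI (z : R) : (\int[leb]_x ((1 + `|z - x|) `^ (- (1 + ep)))%:E = I)%E.
  under eq_integral do rewrite distrC.
  by rewrite /I -(ge0_integral_shift (- z) measurableT mf).
exists (H * (2 * fine I)) => N.
have E (u : nat * int) : (\int[leb]_z ((b0 ^+ u.1) `^ p * (1 + `|u.2%:~R|) `^ (- de)
    * ((1 + `|z|) `^ (- (1 + ep)) + (1 + `|u.2%:~R - z|) `^ (- (1 + ep))))%:E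
    = ((b0 `^ p) ^+ u.1 * (1 + `|u.2%:~R|) `^ (- de) * (2 * fine I))%:E)%E.
  have mh : measurable_fun [set: R]
      (fun x : R => ((1 + `|u.2%:~R - x|) `^ (- (1 + ep)))%:E).
    by apply: eq_measurable_fun (mg u.2%:~R) => x _; rewrite distrC.
  under eq_integral do rewrite EFinM EFinD.
  rewrite ge0_integralZl//; last 2 first.
  - exact: emeasurable_funD.
  - by move=> x _; rewrite adde_ge0// lee_fin powR_ge0.
  rewrite ge0_integralD//; try by move=> x _; rewrite lee_fin powR_ge0.
  rewrite gI -/I powR_exprn ?(ltW b00)// -[I]fineK ?ge0_fin_numE// -EFinD -EFinM.
  by rewrite mulr2n mulrDl mul1r.
under eq_integral do rewrite -sumEFin.
rewrite ge0_integral_sum//; last first.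
  move=> u; apply/measurable_EFinP; apply: measurable_funM => //.
  have mh : measurable_fun [set: R]
      (fun x : R => ((1 + `|u.2%:~R - x|) `^ (- (1 + ep)))%:E).
    by apply: eq_measurable_fun (mg u.2%:~R) => x _; rewrite distrC.
  by apply: measurable_funD; apply/measurable_EFinP.
under eq_bigr do rewrite E.
rewrite sumEFin lee_fin -mulr_suml ler_wpM2r// mulr_ge0// fine_ge0//.
Qed.

Lemma energy_integral_lty (b : R) : ln D / ln l%:R < b < 1 ->
  (\int[leb]_z (F z `^ p * `|z| `^ (- b))%:E < +oo)%E.
Proof.
move=> /andP[db b1]; set d := ln D / ln l%:R in db.
have l1 : 1 < l%:R :> R by rewrite ltr1n (leq_trans _ l3).
have D1 : 1 < D by rewrite ltrDl mulr_gt0// powR_gt0.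
have d0 : 0 < d by rewrite divr_gt0// ln_gt0.
(* This puts [de] at the midpoint of [d] and [b]: still above the critical exponent, with the loss
   [2 * ep] that the kernel splitting requires. *)
pose ep := (b - d) / 4; pose de := b - 2 * ep.
have ep0 : 0 < ep by rewrite divr_gt0// subr_gt0.
have dde : d < de by rewrite /de /ep; lra.
have Dl : D * l%:R `^ (- de) < 1.
  rewrite -ltr_ln ?posrE ?mulr_gt0 ?powR_gt0//; try lra.
  rewrite ln1 lnM ?posrE ?powR_gt0//; try lra.
  by rewrite ln_powR mulNr subr_lt0 -ltr_pdivrMr ?ln_gt0.
have de0 : 0 <= de by lra.
have [K HK] := integral_G_le ep0 de0 Dl.
have h1 : de <= b by rewrite /de; lra.
have h2 : de <= 1 - ep by rewrite /de; lra.
have h3 : b + (1 - ep) = de + 1 + ep by rewrite /de; ring.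
have [C C0 HC] := fourier_le_G ep0 de0 h1 h2 h3.
(* Monotone convergence yields a single majorant with integral at most [K], valid for all levels at
   once. *)
pose GL z := limn (fun N => (G de ep N z)%:E).
have GN z N : ((G de ep N z)%:E <= GL z)%E.
  rewrite /GL (cvg_lim _ (ereal_nondecreasing_cvgn (@G_nondecreasing de ep z)))//.
  by apply: ereal_sup_ubound; exists N.
have GL0 z : (0 <= GL z)%E by apply: le_trans (GN z 0%N); rewrite lee_fin G_ge0.
have mEG N : measurable_fun [set: R] (fun z => (G de ep N z)%:E).
  by apply/measurable_EFinP; exact: measurable_G.
have mGL : measurable_fun [set: R] GL.
  apply: (emeasurable_fun_cvg (fun N z => (G de ep N z)%:E)) => // z _.
  exact: ereal_nondecreasing_is_cvgn.
have IGL : (\int[leb]_z GL z <= K%:E)%E.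
  rewrite monotone_convergence//; last first.
    by move=> N z _; rewrite lee_fin.
  apply: lime_le; last by apply: nearW => N; exact: HK.
  apply: ereal_nondecreasing_is_cvgn => M N MN; apply: ge0_le_integral => //.
  - by move=> z _; rewrite lee_fin.
  - exact: mEG.
  - exact: mEG.
  - by move=> z _; exact: G_nondecreasing.
pose M := (2 * fine (mu setT)) `^ p.
pose h z := (\1_(`]-1, 1[%classic : set R) z * `|z| `^ (- b))%:E.
have M0 : 0 <= M by exact: powR_ge0.
have h0 z : (0 <= h z)%E by rewrite lee_fin mulr_ge0 ?powR_ge0.
have mh : measurable_fun [set: R] h.
  apply/measurable_EFinP; apply: measurable_funM; first exact: measurable_indic.
  by apply: (measurableT_comp (measurable_powR (- b))); exact: normr_measurable.
have Ih : (\int[leb]_z h z < +oo)%E by apply: integral_powR_near0_lty; lra.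
(* For |z| < 1 the transform is bounded by the mass and |z|^(-b) is integrable since 0 < b < 1;
   elsewhere [GL] takes over. *)
apply: (@le_lt_trans _ _ (\int[leb]_z (M%:E * h z + C%:E * GL z))%E).
  apply: ge0_le_integral => //.
  - by move=> z _; rewrite lee_fin mulr_ge0 ?powR_ge0.
  - exact: measurable_energy_integrand.
  - by apply: emeasurable_funD; exact: measurable_funeM.
  move=> z _; have [z1|z1] := ltP `|z| 1.
    rewrite -[leLHS]adde0 leeD ?mule_ge0 ?lee_fin ?(ltW C0)//.
    rewrite /h indicE mem_set; last by rewrite /= in_itv/= -ltr_norml.
    rewrite mul1r ler_wpM2r ?powR_ge0// /M ge0_powR_le//.
    - by have := p2; lra.
    - exact: le_trans (normr_ge0 _) (normc_ge_normRe _).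
    - exact: normc_fourier_le_mass.
  rewrite -[leLHS]add0e leeD ?mule_ge0 ?lee_fin//.
  have := GL0 z; have := GN z; case: (GL z) => [L LN L0| _ _|//].
    by rewrite -EFinM lee_fin; apply: HC => // N; rewrite -lee_fin.
  by rewrite gt0_muley ?lte_fin// leey.
rewrite ge0_integralD//; last 4 first.
- by move=> z _; rewrite mule_ge0// lee_fin.
- exact: measurable_funeM.
- by move=> z _; rewrite mule_ge0// lee_fin ltW.
- exact: measurable_funeM.
rewrite !ge0_integralZl ?lee_fin ?(ltW C0)//.
rewrite lte_add_pinfty// lte_mul_pinfty ?lee_fin ?(ltW C0)//.
exact: le_lt_trans IGL (ltry _).
Qed.

End finite_energy.

(** * From the two energy criteria to the value of the spectrum *)

Theorem corollary3p5 (R : realType) (lambda : nat) (a : R)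
    (mu : {finite_measure set (measurableTypeR R) -> \bar R})
    (lambda_ge3 : (3 <= lambda)%N) (a_itv : -1 <= a <= 1) (a_neq0 : a != 0)
    (mu_riesz : is_riesz_product (fun=> a) (fun=> a_itv) (fun j => (lambda ^ j)%N) mu)
    (theta : R) (theta_itv : 0 <= theta <= 1) :
  fourier_spectrum theta mu =
    (if theta == 0 then 0
     else theta
          - theta * (ln (1 + `|a| `^ (2 / theta) * 2 `^ (1 - 2 / theta))
                     / ln lambda%:R))%:E.
Proof.
have [/andP[th0 th1] [_ a1]] := (theta_itv, andP a_itv).
pose x := fourier_spectrum theta mu.
have x0 : (0 <= x)%E by apply: ereal_sup_ubound; left.
have sx s : 0 <= s -> (fourier_energy s theta mu < +oo)%E -> (s%:E <= x)%E.
  by move=> s0 es; apply: ereal_sup_ubound; right; exists s.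
have [t0|tN0] := eqVneq theta 0.
  (* For theta = 0 every positive exponent has infinite energy, so only the value 0 remains. *)
  apply/eqP; rewrite eq_le x0 andbT; apply: ge_ereal_sup => _ [->//|[s [s0 +] <-]].
  have [s0'|s0'] := leP s 0; first by rewrite lee_fin.
  by rewrite t0 (fourier_energy0_pinfty lambda_ge3 a_neq0 mu_riesz s0') ltxx.
have tgt0 : 0 < theta by rewrite lt_neqAle eq_sym tN0.
pose p := 2 / theta.
have p2 : 2 <= p by rewrite ler_pdivlMr// ler_piMr.
have DE : 1 + `|a| `^ p * 2 `^ (1 - p) = 1 + 2 * (`|a| / 2) `^ p.
  congr (_ + _); rewrite powRM ?invr_ge0// -powR_inv1// -powRrM mulN1r.
  by rewrite mulrCA powRD ?pnatr_eq0 ?implybT// powRr1.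
rewrite -/p DE; set D := 1 + _; set d := ln D / ln _.
have b0 : 0 < `|a| / 2 by rewrite divr_gt0// normr_gt0.
have b1 : `|a| / 2 <= 2^-1 by rewrite ler_piMl ?invr_ge0// ler_norml.
(* From [D <= 2 < lambda] follows [d < 1], which makes the claimed value positive. *)
have D2 : D <= 2.
  have : (`|a| / 2) `^ p <= `|a| / 2 by apply: ge1r_powR; [apply/andP; split|]; lra.
  by rewrite /D; lra.
have l1 : 1 < lambda%:R :> R by rewrite ltr1n; lia.
have d1 : d < 1.
  rewrite ltr_pdivrMr ?ln_gt0// mul1r ltr_ln ?posrE; last 2 first.
  - by rewrite addr_gt0// mulr_gt0// powR_gt0.
  - exact: lt_trans l1.
  by apply: le_lt_trans D2 _; rewrite ltr_nat.
have s00 : 0 < theta - theta * d by rewrite subr_gt0 gtr_pMr.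
apply/eqP; rewrite eq_le; apply/andP; split.
  apply: ge_ereal_sup => _ [->|[s [s0 +] <-]]; first by rewrite lee_fin ltW.
  (* Above the claimed value, the exponent [s / theta - 1] exceeds [- d] and the integral
     diverges. *)
  rewrite lee_fin; apply: contraPT; rewrite -ltNge => s0s.
  rewrite /fourier_energy (negbTE tN0).
  rewrite (energy_integral_pinfty lambda_ge3 a_neq0 mu_riesz p2) ?poweRyr ?ltxx//.
  by rewrite -/D -/d ltrBrDr ltr_pdivlMr//; lra.
have F s : 0 < s -> s < theta - theta * d -> (s%:E <= x)%E.
  move=> s0 s1; apply: sx; first exact: ltW.
  rewrite /fourier_energy (negbTE tN0); apply: poweR_lty.
  (* The condition 0 < s < theta - theta d says exactly that [1 - s / theta] lies strictly between
     [d] and 1. *)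
  have -> : s / theta - 1 = - (1 - s / theta) by ring.
  apply: (energy_integral_lty lambda_ge3 a_neq0 mu_riesz p2).
  rewrite -/D -/d ltrBlDr ltrDl divr_gt0// andbT ltrBrDr -ltrBrDl ltr_pdivrMr//; lra.
rewrite leNgt; apply/negP; change (x < (theta - theta * d)%:E -> False)%E.
move: x0 F; case: x {sx} => [r|//|//]; rewrite lee_fin lte_fin => r0 F rs.
(* If the supremum [r] were smaller than the claimed value, the midpoint would be an exponent of
   finite energy exceeding [r]. *)
have := F ((r + (theta - theta * d)) / 2); rewrite lee_fin => G.
have := G ltac:(lra) ltac:(lra); lra.
Qed.
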